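(* Let $0<\alpha<1$, let $A,B$ be positive semidefinite $n\times n$ matrices, and let $\mathcal{M}_{\alpha,p}$ be any one of $\mathcal{A}_{\alpha,p}$, $\mathcal{H}_{\alpha,p}$, $G_{\alpha,p}$, $SG_{\alpha,p}$, $\widetilde{SG}_{\alpha,p}$, $R_{\alpha,p}$ (defined below), where in the cases $SG_{\alpha,p}$ and $\widetilde{SG}_{\alpha,p}$ it is additionally assumed that $s(A)\ge s(B)$. Then $$LE_\alpha(A,B)=\lim_{p\searrow0}\mathcal{M}_{\alpha,p}(A,B).$$
   Context: For positive semidefinite $A$: $s(A)$ is its support projection; $A^0:=s(A)$; $A^{-1}$ is the generalized inverse (inverse on the range of $s(A)$, zero on its complement), and $A^{-p}:=(A^{-1})^p$ for $p>0$; $\log A$ is the logarithm on the range of $s(A)$, zero on its complement. For positive definite $A,B$: $A\#_\alpha B:=A^{1/2}(A^{-1/2}BA^{-1/2})^\alpha A^{1/2}$, $A!_\alpha B:=((1-\alpha)A^{-1}+\alpha B^{-1})^{-1}$; for positive semidefinite $A,B$ these are extended by $A\#_\alpha B:=\lim_{\varepsilon\searrow0}(A+\varepsilon I)\#_\alpha(B+\varepsilon I)$ and likewise for $!_\alpha$; $\#:=\#_{1/2}$. For $p>0$ and positive semidefinite $A,B$: $\mathcal{A}_{\alpha,p}(A,B):=((1-\alpha)A^p+\alpha B^p)^{1/p}$; $\mathcal{H}_{\alpha,p}(A,B):=(A^p!_\alpha B^p)^{1/p}$; $G_{\alpha,p}(A,B):=(A^p\#_\alpha B^p)^{1/p}$;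 $SG_{\alpha,p}(A,B):=\{(A^{-p}\#B^p)^\alpha A^p(A^{-p}\#B^p)^\alpha\}^{1/p}$; $\widetilde{SG}_{\alpha,p}(A,B):=\{(A^{-p}\#_\alpha B^p)^{1/2}A^{2(1-\alpha)p}(A^{-p}\#_\alpha B^p)^{1/2}\}^{1/p}$; $R_{\alpha,p}(A,B):=(A^{\frac{1-\alpha}{2}p}B^{\alpha p}A^{\frac{1-\alpha}{2}p})^{1/p}$; and $LE_\alpha(A,B):=P_0\exp\{(1-\alpha)P_0(\log A)P_0+\alpha P_0(\log B)P_0\}$ with $P_0:=s(A)\wedge s(B)$ (projection onto the intersection of ranges). *)

(* Defs.v *)
(* MathComp + MathComp-Analysis, complex numbers R[i] from
   mathcomp-real-closed, spectral decomposition from mathcomp/algebra/spectral. *)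
From HB Require Import structures.
From mathcomp Require Import all_boot all_order all_algebra.
From mathcomp Require Import sesquilinear spectral.
From mathcomp Require Import all_classical all_reals all_analysis.
From mathcomp.real_closed Require Import complex.
From Stdlib Require Import ClassicalEpsilon.
Import Order.TTheory GRing.Theory Num.Theory.
Import numFieldTopology.Exports numFieldNormedType.Exports.

Set Implicit Arguments.
Unset Strict Implicit.
Unset Printing Implicit Defensive.

Local Open Scope ring_scope.
Local Open Scope classical_set_scope.
Local Open Scope sesquilinear_scope.

(* The standard (modulus) topology on R[i], as for any numClosedFieldType;
   matrices 'M[R[i]]_n then carry the product (entrywise) topology. *)
HB.instance Definition _ (R : rcfType) :=
  PseudoPointedMetric.copy (complex R) (complex R)^o.

(* Positive semidefinite matrix: Hermitian with nonnegative quadratic form. *)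
Definition psdmx (R : realType) (n : nat) (A : 'M[R[i]]_n) : Prop :=
  A \is hermsymmx /\ forall v : 'rV[R[i]]_n, 0 <= (v *m A *m v ^t*) 0 0.

(* Loewner order: A <= B iff B - A is positive semidefinite. *)
Definition loewner_le (R : realType) (n : nat) (A B : 'M[R[i]]_n) : Prop :=
  psdmx (B - A).

(* Functional calculus for a Hermitian matrix A = U^-1 diag(d) U (spectral
   decomposition of the library, d real): f(A) := U^-1 diag(f(d)) U. *)
Definition fcalc (R : realType) (n : nat) (f : R -> R) (A : 'M[R[i]]_n)
  : 'M[R[i]]_n :=
  invmx (spectralmx A)
  *m diag_mx (map_mx (fun z : R[i] => (f (complex.Re z))%:C%C) (spectral_diag A))
  *m spectralmx A.

(* A^q for q > 0 (on the eigenvalue 0 the value is 0 = 0^q). *)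
Definition mpow (R : realType) (n : nat) (q : R) (A : 'M[R[i]]_n) :=
  fcalc (fun x => if 0 < x then x `^ q else 0) A.

(* support projection s(A) *)
Definition msupp (R : realType) (n : nat) (A : 'M[R[i]]_n) :=
  fcalc (fun x => if x == 0 then 0 else 1) A.

(* generalized inverse A^{-1} (inverse on the range, 0 on the kernel) *)
Definition mginv (R : realType) (n : nat) (A : 'M[R[i]]_n) :=
  fcalc (fun x => if x == 0 then 0 else x^-1) A.

(* A^{-q} := (A^{-1})^q *)
Definition mnpow (R : realType) (n : nat) (q : R) (A : 'M[R[i]]_n) :=
  mpow q (mginv A).

(* log A on the range of s(A), 0 on its complement *)
Definition mlog (R : realType) (n : nat) (A : 'M[R[i]]_n) :=
  fcalc (fun x => if 0 < x then ln x else 0) A.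

(* matrix exponential of a Hermitian matrix *)
Definition mexp (R : realType) (n : nat) (A : 'M[R[i]]_n) := fcalc expR A.

(* X is the (orthogonal) projection onto the intersection of the ranges
   (column spaces) of P and Q. *)
Definition is_meet_proj (R : realType) (n : nat) (P Q X : 'M[R[i]]_n) : Prop :=
  [/\ X \is hermsymmx, X *m X = X & (X^T == (P^T :&: Q^T))%MS].

Definition meet_proj (R : realType) (n : nat) (P Q : 'M[R[i]]_n) : 'M[R[i]]_n :=
  epsilon (inhabits 0) (is_meet_proj P Q).

(* LE_alpha(A,B) *)
Definition LE (R : realType) (n : nat) (a : R) (A B : 'M[R[i]]_n) :=
  let P0 := meet_proj (msupp A) (msupp B) in
  P0 *m mexp (((1 - a)%:C)%C *: (P0 *m mlog A *m P0) + (a%:C)%C *: (P0 *m mlog B *m P0)).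

(* weighted geometric mean, positive definite formula *)
Definition gmean_pd (R : realType) (n : nat) (a : R) (A B : 'M[R[i]]_n) :=
  mpow (2^-1) A *m mpow a (mnpow (2^-1) A *m B *m mnpow (2^-1) A) *m mpow (2^-1) A.

(* A #_a B for positive semidefinite A, B *)
Definition gmean (R : realType) (n : nat) (a : R) (A B : 'M[R[i]]_n) : 'M[R[i]]_n :=
  lim ((fun e : R => gmean_pd a (A + ((e%:C)%C)%:M) (B + ((e%:C)%C)%:M)) @ at_right 0).

(* weighted harmonic mean, positive definite formula *)
Definition hmean_pd (R : realType) (n : nat) (a : R) (A B : 'M[R[i]]_n) :=
  invmx (((1 - a)%:C)%C *: invmx A + (a%:C)%C *: invmx B).

(* A !_a B for positive semidefinite A, B *)
Definition hmean (R : realType) (n : nat) (a : R) (A B : 'M[R[i]]_n) : 'M[R[i]]_n :=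
  lim ((fun e : R => hmean_pd a (A + ((e%:C)%C)%:M) (B + ((e%:C)%C)%:M)) @ at_right 0).

Inductive mean_kind := MeanA | MeanH | MeanG | MeanSG | MeanSGt | MeanR.

(* M_{a,p}(A,B) for the six means *)
Definition mean (R : realType) (n : nat) (k : mean_kind) (a p : R)
  (A B : 'M[R[i]]_n) : 'M[R[i]]_n :=
  match k with
  | MeanA => mpow p^-1 (((1 - a)%:C)%C *: mpow p A + (a%:C)%C *: mpow p B)
  | MeanH => mpow p^-1 (hmean a (mpow p A) (mpow p B))
  | MeanG => mpow p^-1 (gmean a (mpow p A) (mpow p B))
  | MeanSG =>
      let X := gmean (2^-1) (mnpow p A) (mpow p B) in
      mpow p^-1 (mpow a X *m mpow p A *m mpow a X)
  | MeanSGt =>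
      let X := gmean a (mnpow p A) (mpow p B) in
      mpow p^-1 (mpow (2^-1) X *m mpow (2 * (1 - a) * p) A *m mpow (2^-1) X)
  | MeanR =>
      mpow p^-1 (mpow ((1 - a) / 2 * p) A *m mpow (a * p) B
                 *m mpow ((1 - a) / 2 * p) A)
  end.

(* Main.v *)
(** Write M_p = Z_p^(1/p), P0 = s(A) /\ s(B) and K = P0 H P0, where H is the
    first-order coefficient of Z_p and P0 H P0 is the exponent in LE. If P0 Z_p P0
    is at least P0 + pK - o(p) and Z_p is at most E + pH + o(p), where E <= 1 has
    fixed space exactly the range of P0, then the resolvents (c + (1 - Z_p)/p)^-1
    converge to P0 (c - K)^-1: on the complement of P0 the spectral gap of 1 - E is
    blown up by 1/p. A scalar estimate bounds the difference of x^(1/p) and exp(k)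
    by that of the corresponding resolvents, and the Frobenius norm transfers it
    to matrices, so Z_p^(1/p) tends to P0 exp K.

    The two bounds come from A^(cp) = s(A) + p c log A + o(p). R_p and the
    arithmetic mean have such an expansion. The harmonic and geometric means lie
    between the arithmetic mean and Y + Y - Y W Y, a lower bound of the inverse of
    W, where W is the weighted sum of A^-p and B^-p and Y = P0 + pK. When s(B) <=
    s(A), the mean A^-p #_s B^p lives on the range of B and is expanded there by the
    same squeeze, and so are the two spectral means built from it. *)
Require Import Defs.
From HB Require Import structures.
From mathcomp Require Import all_boot all_order all_algebra.
From mathcomp Require Import sesquilinear spectral.
From mathcomp Require Import all_classical all_reals all_analysis.
From mathcomp.real_closed Require Import complex.
From mathcomp Require Import ring lra.
Import Order.TTheory GRing.Theory Num.Theory.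
Import numFieldTopology.Exports numFieldNormedType.Exports.
Set Implicit Arguments.
Unset Strict Implicit.
Unset Printing Implicit Defensive.
Local Open Scope ring_scope.
Local Open Scope classical_set_scope.
Local Open Scope sesquilinear_scope.

Local Notation "r %:C" := (real_complex _ r) (format "r %:C") : ring_scope.
Local Notation Re := complex.Re.
Local Notation Im := complex.Im.
Local Notation conjC := (@Num.conj _).

HB.lock Definition qf (R : realType) (n : nat) (X : 'M[R[i]]_n)
  (v : 'rV[R[i]]_n) : R := Re ((v *m X *m v^t*) 0 0).

HB.lock Definition dg (R : realType) (n : nat) (U : 'M[R[i]]_n)
  (d : 'I_n -> R) : 'M[R[i]]_n := U^t* *m diag_mx (\row_i (d i)%:C) *m U.

HB.lock Definition fro (R : realType) (n : nat) (X : 'M[R[i]]_n) : R :=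
  Re (\tr (X *m X^t*)).

Section QuadraticForm.
Variable R : realType.
Local Notation C := (R[i]).

Definition sqc (z : C) : R := Re z ^+ 2 + Im z ^+ 2.

Lemma sqcE (z : C) : z * conjC z = (sqc z)%:C.
Proof. by rewrite -normCK -add_Re2_Im2. Qed.

Lemma sqc_ge0 (z : C) : 0 <= sqc z.
Proof. by rewrite addr_ge0 // sqr_ge0. Qed.

Lemma conjC_real (r : R) : conjC (r%:C) = r%:C.
Proof. by apply/CrealP; apply/complex_realP; exists r. Qed.

Lemma sqcM (z w : C) : sqc (z * w) = sqc z * sqc w.
Proof. by rewrite /sqc; case: z w => [a b] [c d] /=; ring. Qed.

Lemma sqc_real (r : R) : sqc r%:C = r ^+ 2.
Proof. by rewrite /sqc /= expr0n /= addr0. Qed.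

Lemma sqc0 : sqc 0 = 0.
Proof. by rewrite /sqc /= expr0n addr0. Qed.

Lemma sqc_eq0 (z : C) : sqc z = 0 -> z = 0.
Proof.
move=> /(congr1 (real_complex R)); rewrite -sqcE => /eqP.
by rewrite mulf_eq0 conjC_eq0 orbb => /eqP.
Qed.

Lemma ReMc (z w : C) : Re (z * w) = Re z * Re w - Im z * Im w.
Proof. by case: z w => [? ?] [? ?]. Qed.

Lemma ImMc (z w : C) : Im (z * w) = Re z * Im w + Im z * Re w.
Proof. by case: z w => [? ?] [? ?]. Qed.

Lemma ImM (r : R) (z : C) : Im (r%:C * z) = r * Im z.
Proof. by case: z => a b /=; rewrite mul0r addr0. Qed.

Lemma Im_sum (I : Type) (r : seq I) (P : pred I) (F : I -> C) :
  Im (\sum_(i <- r | P i) F i) = \sum_(i <- r | P i) Im (F i).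
Proof. by apply: (big_morph (@complex.Im R)) => [[? ?] [? ?]|]. Qed.

Lemma ImD (z w : C) : Im (z + w) = Im z + Im w.
Proof. by case: z w => [? ?] [? ?]. Qed.

Lemma ImN (z : C) : Im (- z) = - Im z.
Proof. by case: z. Qed.

Lemma ReM (r : R) (z : C) : Re (r%:C * z) = r * Re z.
Proof. by case: z => a b /=; rewrite mul0r subr0. Qed.

Lemma Re_sum (I : Type) (r : seq I) (P : pred I) (F : I -> C) :
  Re (\sum_(i <- r | P i) F i) = \sum_(i <- r | P i) Re (F i).
Proof. by apply: (big_morph (@complex.Re R)) => [[? ?] [? ?]|]. Qed.

Lemma ReD (z w : C) : Re (z + w) = Re z + Re w.
Proof. by case: z w => [? ?] [? ?]. Qed.

Lemma ReN (z : C) : Re (- z) = - Re z.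
Proof. by case: z. Qed.

Variable n : nat.
Implicit Types (X Y A B U V : 'M[C]_n) (d e : 'I_n -> R) (v w : 'rV[C]_n).

Lemma adjM m p q (A : 'M[C]_(m, p)) (B : 'M[C]_(p, q)) :
  (A *m B)^t* = B^t* *m A^t*.
Proof. by rewrite trmx_mul map_mxM. Qed.

Lemma adjD m p (A B : 'M[C]_(m, p)) : (A + B)^t* = A^t* + B^t*.
Proof. by apply/matrixP => i j; rewrite !mxE rmorphD. Qed.

Lemma adjN m p (A : 'M[C]_(m, p)) : (- A)^t* = - A^t*.
Proof. by apply/matrixP => i j; rewrite !mxE rmorphN. Qed.

Lemma adjZ m p (r : R) (A : 'M[C]_(m, p)) : (r%:C *: A)^t* = r%:C *: A^t*.
Proof. by apply/matrixP => i j; rewrite !mxE rmorphM /= conjC_real. Qed.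

Lemma herm_lin m (r s : R) (A B : 'M[C]_m) : A^t* = A -> B^t* = B ->
  (r%:C *: A + s%:C *: B)^t* = r%:C *: A + s%:C *: B.
Proof. by move=> hA hB; rewrite adjD !adjZ hA hB. Qed.

Lemma adj1 : (1%:M : 'M[C]_n)^t* = 1%:M.
Proof. by rewrite trmx1 map_mx1. Qed.

Lemma adj0 m p : (0 : 'M[C]_(m, p))^t* = 0.
Proof. by apply/matrixP => i j; rewrite !mxE conjC0. Qed.

Definition adjE := (adjM, adjD, adjN, adjZ, adj1, adj0, @trmxCK).

Lemma hermP X : reflect (X^t* = X) (X \is hermsymmx).
Proof.
apply: (iffP (is_hermitianmxP _ _ _)); rewrite expr0 scale1r; exact: esym.
Qed.

Definition nsq v : R := \sum_i sqc (v 0 i).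

Lemma qfD X Y v : qf (X + Y) v = qf X v + qf Y v.
Proof. by rewrite qf.unlock mulmxDr mulmxDl mxE ReD. Qed.

Lemma qfN X v : qf (- X) v = - qf X v.
Proof. by rewrite qf.unlock mulmxN mulNmx mxE ReN. Qed.

Lemma qfZ (r : R) X v : qf (r%:C *: X) v = r * qf X v.
Proof. by rewrite qf.unlock -scalemxAr -scalemxAl mxE ReM. Qed.

Lemma qf0 v : qf 0 v = 0.
Proof. by rewrite qf.unlock mulmx0 mul0mx mxE. Qed.

Lemma qf1 v : qf 1%:M v = nsq v.
Proof.
rewrite qf.unlock mulmx1 mxE Re_sum; apply: eq_bigr => i _.
by rewrite !mxE sqcE.
Qed.

Lemma qf_congr m (Y : 'M[C]_(n, m)) (X : 'M[C]_m) v :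
  qf (Y *m X *m Y^t*) v = Re ((v *m Y *m X *m (v *m Y)^t*) 0 0).
Proof. by rewrite qf.unlock adjM !mulmxA. Qed.

Lemma nsq_ge0 v : 0 <= nsq v.
Proof. by apply: sumr_ge0 => i _; exact: sqc_ge0. Qed.

Lemma nsq_eq0 v : nsq v = 0 -> v = 0.
Proof.
move=> /psumr_eq0P v0; apply/rowP => i; rewrite mxE; apply: sqc_eq0.
by apply: v0 => // j _; exact: sqc_ge0.
Qed.

Lemma herm_form_real X v : X^t* = X ->
  (v *m X *m v^t*) 0 0 = (qf X v)%:C.
Proof.
move=> hX; rewrite qf.unlock; set z := (_ *m _ *m _) 0 0.
suff /CrealP/RRe_real -> : conjC z = z by [].
rewrite /z; have /matrixP/(_ 0 0) : (v *m X *m v^t*)^t* = v *m X *m v^t*.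
  by rewrite !adjE hX mulmxA.
by rewrite !mxE.
Qed.

Lemma psdmxP X : psdmx X <-> X^t* = X /\ forall v, 0 <= qf X v.
Proof.
split=> -[hX pX]; split.
- exact/hermP.
- by move=> v; have := pX v; rewrite herm_form_real ?lecR ?ler0c//; exact/hermP.
- exact/hermP.
- by move=> v; rewrite herm_form_real // ler0c.
Qed.

Lemma dgE U d i j : dg U d i j = \sum_k (d k)%:C * (conjC (U k i) * U k j).
Proof.
rewrite dg.unlock -mulmxA mul_diag_mx mxE; apply: eq_bigr => k _.
by rewrite !mxE mulrCA.
Qed.

Lemma eq_dg U d e : d =1 e -> dg U d = dg U e.
Proof. by move=> de; apply/matrixP => i j; rewrite !dgE; apply: eq_bigr => k _; rewrite de. Qed.

Lemma dgD U d e : dg U d + dg U e = dg U (fun i => d i + e i).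
Proof.
apply/matrixP => i j; rewrite mxE !dgE -big_split; apply: eq_bigr => k _ /=.
by rewrite -mulrDl rmorphD.
Qed.

Lemma dgZ U r d : r%:C *: dg U d = dg U (fun i => r * d i).
Proof.
apply/matrixP => i j; rewrite mxE !dgE mulr_sumr; apply: eq_bigr => k _ /=.
by rewrite rmorphM mulrA.
Qed.

Lemma dgN U d : - dg U d = dg U (fun i => - d i).
Proof.
apply/matrixP => i j; rewrite mxE !dgE -sumrN; apply: eq_bigr => k _ /=.
by rewrite rmorphN mulNr.
Qed.

Lemma dg_herm U d : (dg U d)^t* = dg U d.
Proof.
apply/matrixP => i j; rewrite 2!mxE !dgE rmorph_sum; apply: eq_bigr => k _ /=.
by rewrite !rmorphM /= conjC_real conjCK [U k j * _]mulrC.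
Qed.

Lemma qf_dg U d v : qf (dg U d) v = \sum_k d k * sqc ((v *m U^t*) 0 k).
Proof.
have -> : dg U d = U^t* *m diag_mx (\row_i (d i)%:C) *m (U^t*)^t*.
  by rewrite dg.unlock trmxCK.
rewrite qf_congr; set w := v *m U^t*.
rewrite mul_mx_diag mxE Re_sum; apply: eq_bigr => k _.
by rewrite !mxE mulrAC sqcE mulrC ReM.
Qed.

Lemma unitaryP U : reflect (U^t* *m U = 1%:M) (U \is unitarymx).
Proof.
apply: (iffP (@unitarymxP _ _ _ U)) => [/mulmx1C|/mulmx1C] //.
Qed.

Lemma dg1 U : U \is unitarymx -> dg U (fun=> 1) = 1%:M.
Proof.
move=> /unitaryP; rewrite dg.unlock => UU.
have -> : \row_(i < n) (1%:C : C) = const_mx 1 by apply/rowP => i; rewrite !mxE.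
by rewrite diag_const_mx mulmx1.
Qed.

Lemma dg_mul U d e : U \is unitarymx ->
  dg U d *m dg U e = dg U (fun i => d i * e i).
Proof.
move=> hU; rewrite dg.unlock.
set D := diag_mx _; set E := diag_mx _; set F := diag_mx _.
have -> : U^t* *m D *m U *m (U^t* *m E *m U) = U^t* *m (D *m E) *m U.
  by rewrite !mulmxA (mulmxtVK _ hU).
have -> // : D *m E = F.
rewrite mulmx_diag /F; have -> // : \row_i (d i * e i)%:C =
  \row_i ((\row_i (d i)%:C) 0 i * (\row_i (e i)%:C) 0 i) :> 'rV[C]_n.
by apply/rowP => i; rewrite !mxE rmorphM.
Qed.

Lemma nsq_unitary U v : U \is unitarymx -> nsq (v *m U^t*) = nsq v.
Proof.
move=> UU; rewrite -[RHS]qf1 -(dg1 UU) qf_dg.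
by apply: eq_bigr => i _; rewrite mul1r.
Qed.

Lemma spectral_dg X : X^t* = X ->
  dg (spectralmx X) (fun i => Re (spectral_diag X 0 i)) = X.
Proof.
move=> /hermP hX; have /hermitian_normalmx /orthomx_spectralP E := hX.
rewrite [RHS]E (invmx_unitary (spectral_unitarymx X)) dg.unlock.
suff -> : \row_i (Re (spectral_diag X 0 i))%:C = spectral_diag X by [].
apply/rowP => i; rewrite !mxE RRe_real //.
by have /mxOverP -> := hermitian_spectral_diag_real hX.
Qed.

Lemma herm_dg X : X^t* = X -> exists U d, U \is unitarymx /\ X = dg U d.
Proof.
move=> hX; exists (spectralmx X), (fun i => Re (spectral_diag X 0 i)).
by rewrite spectral_dg // spectral_unitarymx.
Qed.

Lemma fcalcE f X : X^t* = X ->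
  fcalc f X = dg (spectralmx X) (fun i => f (Re (spectral_diag X 0 i))).
Proof.
move=> hX; rewrite /fcalc dg.unlock (invmx_unitary (spectral_unitarymx X)).
have -> : map_mx (fun z : C => (f (Re z))%:C) (spectral_diag X) =
  \row_i (f (Re (spectral_diag X 0 i)))%:C by apply/rowP => i; rewrite !mxE.
by [].
Qed.

Lemma froE X : fro X = \sum_i \sum_j sqc (X i j).
Proof.
rewrite fro.unlock /mxtrace Re_sum; apply: eq_bigr => i _; rewrite mxE Re_sum.
by apply: eq_bigr => j _; rewrite !mxE sqcE.
Qed.

Lemma fro_ge0 X : 0 <= fro X.
Proof.
by rewrite froE; do 2![apply: sumr_ge0 => ? _]; exact: sqc_ge0.
Qed.

Lemma fro_entry X i j : sqc (X i j) <= fro X.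
Proof.
rewrite froE (bigD1 i) //= (bigD1 j) //= -addrA lerDl.
apply: addr_ge0; first by apply: sumr_ge0 => ? _; exact: sqc_ge0.
by do 2![apply: sumr_ge0 => ? _]; exact: sqc_ge0.
Qed.

Lemma fro_eq0 X : fro X = 0 -> X = 0.
Proof.
move=> X0; apply/matrixP => i j; rewrite mxE; apply: sqc_eq0.
by apply: le_anti; rewrite sqc_ge0 -{1}X0 fro_entry.
Qed.

Lemma fro_unitaryl U X : U \is unitarymx -> fro (U *m X) = fro X.
Proof.
move=> /unitaryP UU; rewrite fro.unlock adjM mulmxA mxtrace_mulC.
by rewrite !mulmxA UU mul1mx.
Qed.

Lemma fro_unitaryr U X : U \is unitarymx -> fro (X *m U^t*) = fro X.
Proof. by move=> /unitaryP UU; rewrite fro.unlock adjM trmxCK -!mulmxA (mulmxA _ U) UU mul1mx. Qed.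

Lemma fro_dgB U V d e : U \is unitarymx -> V \is unitarymx ->
  fro (dg U d - dg V e) =
  \sum_i \sum_j (d i - e j) ^+ 2 * sqc ((U *m V^t*) i j).
Proof.
move=> hU hV; rewrite -(fro_unitaryl _ hU) -(fro_unitaryr _ hV) froE.
apply: eq_bigr => i _; apply: eq_bigr => j _.
have -> : U *m (dg U d - dg V e) *m V^t* =
  diag_mx (\row_i (d i)%:C) *m (U *m V^t*)
  - (U *m V^t*) *m diag_mx (\row_i (e i)%:C).
  move/unitarymxP: hU => hU; move/unitarymxP: hV => hV.
  rewrite mulmxBr mulmxBl dg.unlock !mulmxA hU mul1mx.
  by rewrite -(mulmxA _ V) hV mulmx1.
rewrite mul_diag_mx mul_mx_diag; move: (U *m V^t*) => W.
by rewrite !mxE [W i j * _]mulrC -mulrBl -rmorphB sqcM sqc_real.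
Qed.

Lemma fro_unitary U : U \is unitarymx -> fro U = n%:R.
Proof.
move=> /unitarymxP UU; rewrite fro.unlock UU mxtrace1.
by rewrite -(rmorph_nat (real_complex R)).
Qed.

(* The squared distance of two functions of Hermitian matrices is an average
   of squared scalar distances over pairs of eigenvalues, with weights that do
   not depend on the functions: scalar estimates transfer to matrices. *)
Lemma fro_dg_transfer U V (d d' e e' : 'I_n -> R) (r M : R) :
  U \is unitarymx -> V \is unitarymx ->
  (forall i j, (d' i - e' j) ^+ 2 <= r + M * (d i - e j) ^+ 2) ->
  fro (dg U d' - dg V e') <= n%:R * r + M * fro (dg U d - dg V e).
Proof.
move=> hU hV H; rewrite !fro_dgB //.
have hW : U *m V^t* \is unitarymx by exact: mul_unitarymx hU (etrans (trmxC_unitary V) hV).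
rewrite -(fro_unitary hW) froE; move: (U *m V^t*) => W.
rewrite mulr_sumr mulr_suml -big_split; apply: ler_sum => i _ /=.
rewrite mulr_sumr mulr_suml -big_split; apply: ler_sum => j _ /=.
rewrite mulrA [sqc _ * _]mulrC -mulrDl ler_wpM2r ?sqc_ge0 //.
Qed.

Lemma dg_funct U V d e (f : R -> R) : U \is unitarymx -> V \is unitarymx ->
  dg U d = dg V e -> dg U (fun i => f (d i)) = dg V (fun i => f (e i)).
Proof.
move=> hU hV E; apply/subr0_eq/fro_eq0; rewrite fro_dgB //.
have : fro (dg U d - dg V e) = 0 by rewrite E subrr froE big1 // => i _;
  rewrite big1 // => j _; rewrite mxE sqc0.
rewrite fro_dgB // => /psumr_eq0P H.
rewrite big1 // => i _; rewrite big1 // => j _ /=.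
have pos k l : 0 <= (d k - e l) ^+ 2 * sqc ((U *m V^t*) k l).
  by rewrite mulr_ge0 ?sqr_ge0 ?sqc_ge0.
have /psumr_eq0P := H (fun i _ => sumr_ge0 _ (fun j _ => pos i j)) i isT.
move=> /(_ (fun j _ => pos i j)) /(_ j isT) /eqP.
rewrite mulf_eq0 sqrf_eq0 subr_eq0 => /orP[/eqP->|/eqP->].
  by rewrite subrr expr0n mul0r.
by rewrite mulr0.
Qed.

Lemma fcalc_dg f U d : U \is unitarymx -> fcalc f (dg U d) = dg U (fun i => f (d i)).
Proof.
move=> hU; have hX := dg_herm U d; rewrite fcalcE //.
exact: dg_funct (spectral_unitarymx _) hU (spectral_dg hX).
Qed.

Lemma dg_row U d k : U \is unitarymx -> row k U *m dg U d = (d k)%:C *: row k U.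
Proof.
move=> /unitarymxP hU; rewrite -row_mul dg.unlock !mulmxA hU mul1mx.
by apply/rowP => j; rewrite mul_diag_mx !mxE.
Qed.

Lemma nsq_row U k : U \is unitarymx -> nsq (row k U) = 1.
Proof.
move=> hU; rewrite /nsq; have /unitarymxP/matrixP/(_ k k) := hU.
rewrite !mxE eqxx mulr1n => /(congr1 (@complex.Re R)); rewrite Re_sum /= => <-.
by apply: eq_bigr => i _; rewrite !mxE sqcE.
Qed.

Lemma qf_dg_row U d k : U \is unitarymx -> qf (dg U d) (row k U) = d k.
Proof.
move=> hU; rewrite qf.unlock dg_row // -scalemxAl mxE ReM.
by have := nsq_row k hU; rewrite -qf1 qf.unlock mulmx1 => ->; rewrite mulr1.
Qed.

Lemma psd_dg U d : U \is unitarymx -> (forall v, 0 <= qf (dg U d) v) ->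
  forall i, 0 <= d i.
Proof. by move=> hU H i; rewrite -(qf_dg_row d i hU). Qed.

Lemma ler_qf_dg U d e v : (forall i, d i <= e i) ->
  qf (dg U d) v <= qf (dg U e) v.
Proof.
by move=> H; rewrite !qf_dg; apply: ler_sum => i _; rewrite ler_wpM2r ?sqc_ge0.
Qed.

End QuadraticForm.

Definition leo (R : realType) (n : nat) (X Y : 'M[R[i]]_n) :=
  forall v, qf X v <= qf Y v.
Local Notation "X <=o Y" := (leo X Y) (at level 70, no associativity).

Ltac mxexp := rewrite ?(mulmxBl, mulmxBr, mulmxDl, mulmxDr, mulNmx, mulmxN,
  mul1mx, mulmx1, mul0mx, mulmx0, mulmxA) -?(scalemxAl, scalemxAr)
  ?(mulmxBl, mulmxBr, mulmxDl, mulmxDr, mulNmx, mulmxN,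
  mul1mx, mulmx1, mul0mx, mulmx0, mulmxA).

Ltac mxlin :=
  repeat match goal with |- context [mulmx ?A ?B] =>
    let P := fresh in move: (mulmx A B) => P end;
  let i := fresh "i" in let j := fresh "j" in
  apply/matrixP => i j; rewrite !mxE; ring.

Section Order.
Variable R : realType.
Local Notation C := (R[i]).
Variable n : nat.
Implicit Types (X Y Z A B U V S T : 'M[C]_n) (d e : 'I_n -> R) (v w : 'rV[C]_n).

Lemma qfB X Y v : qf (X - Y) v = qf X v - qf Y v.
Proof. by rewrite qfD qfN. Qed.

Lemma qf_conj X Y v : qf (Y *m X *m Y^t*) v = qf X (v *m Y).
Proof. by rewrite qf_congr qf.unlock. Qed.

Lemma leo_conj Y X Z : X <=o Z -> Y *m X *m Y^t* <=o Y *m Z *m Y^t*.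
Proof. by move=> H v; rewrite !qf_conj. Qed.

Lemma leo_conjh Y X Z : Y^t* = Y -> X <=o Z -> Y *m X *m Y <=o Y *m Z *m Y.
Proof. by move=> hY /(leo_conj Y); rewrite hY. Qed.

Lemma leo_refl X : X <=o X. Proof. by []. Qed.

Lemma leo_trans Y X Z : X <=o Y -> Y <=o Z -> X <=o Z.
Proof. by move=> h1 h2 v; apply: le_trans (h2 v). Qed.

Lemma leo_dg U d e : (forall i, d i <= e i) -> dg U d <=o dg U e.
Proof. by move=> H v; exact: ler_qf_dg. Qed.

Definition pd X := X^t* = X /\ exists2 c : R, 0 < c & forall v, c * nsq v <= qf X v.

Lemma qf_scalar (r : R) v : qf (r%:C)%:M v = r * nsq v.
Proof. by rewrite -scalemx1 qfZ qf1. Qed.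

Lemma scalar_herm (r : R) : ((r%:C)%:M : 'M[C]_n)^t* = (r%:C)%:M.
Proof. by rewrite -scalemx1 adjZ adj1. Qed.

Lemma pd_psdD X (r : R) : psdmx X -> 0 < r -> pd (X + (r%:C)%:M).
Proof.
move=> /psdmxP[hX pX] r0; split; first by rewrite adjD scalar_herm hX.
by exists r => // v; rewrite qfD qf_scalar lerDr.
Qed.

Lemma pd_dg X : pd X ->
  exists U d, [/\ U \is unitarymx, forall i, 0 < d i & X = dg U d].
Proof.
move=> [/herm_dg[U [d [hU ->]]] [c c0 H]]; exists U, d; split => // i.
by apply: lt_le_trans c0 _; rewrite -(qf_dg_row d i hU) -[c]mulr1 -(nsq_row i hU).
Qed.

Lemma dg_mulr V Y d : dg (V *m Y) d = Y^t* *m dg V d *m Y.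
Proof. by rewrite dg.unlock adjM !mulmxA. Qed.

Lemma dg_mulV T d e : T \in unitmx -> (forall i, d i * e i = 1) ->
  dg T d *m dg ((invmx T)^t*) e = 1%:M.
Proof.
move=> uT de; rewrite dg.unlock trmxCK !mulmxA mulmxK //.
rewrite -(mulmxA (T^t* )) mulmx_diag.
have -> : \row_i ((\row_i (d i)%:C) 0 i * (\row_i (e i)%:C) 0 i) = const_mx 1 :> 'rV[C]_n.
  by apply/rowP => i; rewrite !mxE -rmorphM de.
by rewrite diag_const_mx mulmx1 -adjM mulVmx // adj1.
Qed.

Lemma unit_adj T : T \in unitmx -> T^t* \in unitmx.
Proof. by rewrite map_unitmx unitmx_tr. Qed.

Lemma invmx_eq X Y : X *m Y = 1%:M -> invmx X = Y.
Proof.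
move=> XY; have [uX _] := mulmx1_unit XY.
by rewrite -[LHS]mulmx1 -XY mulKmx.
Qed.

Lemma invmx_dg T d : T \in unitmx -> (forall i, d i != 0) ->
  invmx (dg T d) = dg ((invmx T)^t*) (fun i => (d i)^-1).
Proof.
by move=> uT d0; apply: invmx_eq; apply: dg_mulV => // i; rewrite divff.
Qed.

Lemma invmx_dg_unitary U d : U \is unitarymx -> (forall i, d i != 0) ->
  invmx (dg U d) = dg U (fun i => (d i)^-1).
Proof.
move=> hU d0; apply: invmx_eq; rewrite dg_mul // -[RHS](dg1 hU).
by apply: eq_dg => i; rewrite divff.
Qed.

Lemma leo_dg_inv T d e : T \in unitmx -> dg T d <=o dg T e ->
  forall i, d i <= e i.
Proof.
move=> uT H i; have := H ('e_i *m invmx (T^t*)); rewrite !qf_dg.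
rewrite mulmxKV ?unit_adj // (bigD1 i) //= [X in _ <= X](bigD1 i) //=.
rewrite !big1 => [| j ji | j ji]; first last.
- by rewrite mxE (negbTE ji) andbF sqc0 mulr0.
- by rewrite mxE (negbTE ji) andbF sqc0 mulr0.
by rewrite !mxE !eqxx /= (_ : sqc 1 = 1) ?mulr1 ?addr0 // /sqc /= expr1n expr0n addr0.
Qed.

Lemma mpowE (q : R) U d : U \is unitarymx -> (forall i, 0 < d i) ->
  mpow q (dg U d) = dg U (fun i => d i `^ q).
Proof.
by move=> hU d0; rewrite /mpow fcalc_dg //; apply: eq_dg => i; rewrite d0.
Qed.

Lemma mginvE U d : U \is unitarymx -> (forall i, 0 < d i) ->
  mginv (dg U d) = dg U (fun i => (d i)^-1).
Proof.
by move=> hU d0; rewrite /mginv fcalc_dg //; apply: eq_dg => i; rewrite gt_eqF.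
Qed.

Lemma pd_sqrt A : pd A ->
  let H := mpow 2^-1 A in let G := mnpow 2^-1 A in
  [/\ H^t* = H, G^t* = G, H *m H = A, G *m H = 1%:M & H *m G = 1%:M].
Proof.
move=> /pd_dg[U [d [hU d0 ->]]] H G.
have HE : H = dg U (fun i => d i `^ 2^-1) by rewrite /H mpowE.
have GE : G = dg U (fun i => (d i)^-1 `^ 2^-1).
  by rewrite /G /mnpow mginvE // mpowE // => i; rewrite invr_gt0.
have sq (x : R) : 0 < x -> x `^ 2^-1 * x `^ 2^-1 = x.
  move=> x0; rewrite -powRD ?gt_eqF ?implybT //.
  have -> : 2^-1 + 2^-1 = 1 :> R by field.
  by rewrite powRr1 // ltW.
have GH (x : R) : 0 < x -> x^-1 `^ 2^-1 * x `^ 2^-1 = 1.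
  by move=> x0; rewrite -powRM ?invr_ge0 ?ltW // mulVf ?gt_eqF // powR1.
rewrite HE GE !dg_herm !dg_mul //; split => //; rewrite -?(dg1 hU).
- by apply: eq_dg => i; rewrite sq.
- by apply: eq_dg => i; rewrite GH.
- by apply: eq_dg => i; rewrite mulrC GH.
Qed.

Lemma pd_congr A B : pd A -> pd B -> exists T d,
  [/\ T \in unitmx, forall i, 0 < d i, A = dg T (fun=> 1) & B = dg T d].
Proof.
move=> pA [hB [c c0 Hc]].
have [] := pd_sqrt pA; move: (mpow _ A) (mnpow _ A) => H G hH hG HH GH HG.
have hM : (G *m B *m G)^t* = G *m B *m G by rewrite !adjM hG hB mulmxA.
have [V [d [hV Vd]]] := herm_dg hM.
have uV := unitarymx_unit hV.
have [uG uH] := mulmx1_unit GH.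
exists (V *m H), d; split.
- by rewrite unitmx_mul uV uH.
- move=> i; rewrite -(qf_dg_row d i hV) -Vd -{2}hG qf_conj.
  apply: lt_le_trans (Hc _); rewrite mulr_gt0 // lt_neqAle nsq_ge0 andbT eq_sym.
  apply/eqP => /nsq_eq0 /(congr1 (mulmx^~ H)); rewrite -mulmxA GH mulmx1 mul0mx.
  move=> r0; have := nsq_row i hV; rewrite r0 /nsq big1 => [/eqP|? _].
    by rewrite eq_sym oner_eq0.
  by rewrite mxE sqc0.
- by rewrite dg_mulr dg1 // mulmx1 hH HH.
- by rewrite dg_mulr -Vd hH !mulmxA HG mul1mx -mulmxA GH mulmx1.
Qed.

Lemma gmean_pd_dg (a : R) T d : T \in unitmx -> (forall i, 0 < d i) ->
  pd (dg T (fun=> 1)) ->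
  gmean_pd a (dg T (fun=> 1)) (dg T d) = dg T (fun i => d i `^ a).
Proof.
move=> uT d0 pA; rewrite /gmean_pd.
have [] := pd_sqrt pA; move: (mpow _ (dg T (fun=> 1))) (mnpow _ _) => H G.
set A := dg _ _ => hH hG HH GH HG.
have hW : T *m G \is unitarymx.
  apply/unitaryP; rewrite adjM hG.
  have -> : G *m T^t* *m (T *m G) = G *m A *m G.
    rewrite /A dg.unlock (_ : \row__ _ = const_mx 1); last by apply/rowP => i; rewrite !mxE.
    by rewrite diag_const_mx mulmx1 !mulmxA.
  by rewrite -HH mulmxA GH mul1mx HG.
have -> : G *m dg T d *m G = dg (T *m G) d by rewrite dg_mulr hG.
rewrite mpowE // -{1}hH -dg_mulr -(mulmxA T) GH mulmx1 //.
Qed.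

Lemma hmean_pd_dg (a : R) T d : 0 < a < 1 -> T \in unitmx -> (forall i, 0 < d i) ->
  hmean_pd a (dg T (fun=> 1)) (dg T d) =
  dg T (fun i => ((1 - a) + a * (d i)^-1)^-1).
Proof.
move=> /andP[a0 a1] uT d0; rewrite /hmean_pd.
have dn0 i : d i != 0 by rewrite gt_eqF.
have o0 (i : 'I_n) : (1 : R) != 0 by rewrite oner_eq0.
rewrite (invmx_dg uT o0) (invmx_dg uT dn0) !dgZ dgD.
rewrite invmx_dg; last 2 first.
- by rewrite unit_adj // unitmx_inv.
- move=> i; rewrite gt_eqF // invr1 mulr1 addr_gt0 ?subr_gt0 // mulr_gt0 ?invr_gt0 //.
have -> : (invmx ((invmx T)^t*))^t* = T.
  rewrite -[RHS]trmxCK; congr (_ ^t*); apply: invmx_eq.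
  by rewrite -adjM mulmxV // adj1.
by apply: eq_dg => i; rewrite invr1 mulr1.
Qed.

Lemma inv_antitone A B : pd A -> pd B -> A <=o B -> invmx B <=o invmx A.
Proof.
move=> pA pB; have [T [d [uT d0 -> ->]]] := pd_congr pA pB => H.
have d1 := leo_dg_inv uT H.
have dn0 i : d i != 0 by rewrite gt_eqF.
have o0 (i : 'I_n) : (1 : R) != 0 by rewrite oner_eq0.
rewrite (invmx_dg uT o0) (invmx_dg uT dn0).
by apply: leo_dg => i; rewrite invr1 invf_le1.
Qed.

Lemma pd_unit A : pd A -> A \in unitmx.
Proof.
move=> /pd_dg[U [d [hU d0 ->]]].
by have /mulmx1_unit[] // := @dg_mulV U d (fun i => (d i)^-1)
  (unitarymx_unit hU) (fun i => divff (lt0r_neq0 (d0 i))).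
Qed.

Lemma pd_inv_ge0 A : pd A -> 0 <=o invmx A.
Proof.
move=> /pd_dg[U [d [hU d0 ->]]]; rewrite invmx_dg_unitary => [v|//|i]; last by rewrite gt_eqF.
rewrite qf0 qf_dg; apply: sumr_ge0 => i _.
by rewrite mulr_ge0 ?sqc_ge0 // invr_ge0 ltW.
Qed.

(* Expand (1 - Y W) W^-1 (1 - W Y) >= 0. *)
Lemma inv_lower_bound W Y : pd W -> Y^t* = Y ->
  Y + Y - Y *m W *m Y <=o invmx W.
Proof.
move=> pW hY v; have uW := pd_unit pW.
have := leo_conj (1%:M - Y *m W) (pd_inv_ge0 pW) v.
have -> : (1%:M - Y *m W) *m invmx W *m (1%:M - Y *m W)^t* =
  invmx W - (Y + Y - Y *m W *m Y).
  rewrite !adjE (proj1 pW) hY mulmxBl mul1mx mulmxK //.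
  rewrite mulmxBr mulmx1 mulmxBl !mulmxA mulVmx // mul1mx.
  by mxlin.
by rewrite mulmx0 mul0mx qf0 qfB subr_ge0.
Qed.

Lemma psd_dgP X : psdmx X -> exists U d,
  [/\ U \is unitarymx, forall i, 0 <= d i & X = dg U d].
Proof.
move=> /psdmxP[/herm_dg[U [d [hU ->]]] H]; exists U, d; split => //.
exact: psd_dg hU H.
Qed.

Lemma sqrt_monotone D Z : D^t* = D -> Z^t* = Z -> 0 <=o D ->
  Z *m Z <=o D *m D -> Z <=o D.
Proof.
move=> hD hZ D0 H.
have hDZ : (D - Z)^t* = D - Z by rewrite !adjE hD hZ.
have [V [l [hV E]]] := herm_dg hDZ.
suff l0 i : 0 <= l i.
  move=> v; rewrite -subr_ge0 -qfB E qf_dg; apply: sumr_ge0 => i _.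
  by rewrite mulr_ge0 ?sqc_ge0.
rewrite leNgt; apply/negP => li.
have := H (row i V); rewrite -subr_ge0 -qfB.
have e1 : row i V *m (D - Z) = (l i)%:C *: row i V by rewrite E dg_row.
have e2 : (D - Z) *m (row i V)^t* = (l i)%:C *: (row i V)^t*.
  by rewrite -hDZ -adjM e1 adjZ.
have -> : qf (D *m D - Z *m Z) (row i V) = l i * qf (D + Z) (row i V).
  have h1 : qf ((D - Z) *m (D + Z)) (row i V) = l i * qf (D + Z) (row i V).
    by rewrite qf.unlock !mulmxA e1 -!scalemxAl mxE ReM.
  have h2 : qf ((D + Z) *m (D - Z)) (row i V) = l i * qf (D + Z) (row i V).
    by rewrite qf.unlock -!mulmxA e2 -!scalemxAr mxE ReM.
  have : (D - Z) *m (D + Z) + (D + Z) *m (D - Z) =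
         (D *m D - Z *m Z) + (D *m D - Z *m Z).
    by mxexp; mxlin.
  move=> /(congr1 (fun X => qf X (row i V))).
  rewrite [LHS]qfD [RHS]qfD h1 h2; lra.
rewrite nmulr_rge0 // qfD => h1.
have := qf_dg_row l i hV; rewrite -E qfB => h2.
have := D0 (row i V); rewrite qf0 => h3.
by move: h1 h2 h3 li; lra.
Qed.

Lemma dg_mul_dual S T d e (f : 'I_n -> R) : S *m T = 1%:M ->
  dg S d *m dg (T^t*) e *m dg S f = dg S (fun i => d i * e i * f i).
Proof.
move=> ST; have ST' : T^t* *m S^t* = 1%:M by rewrite -adjM ST adj1.
rewrite dg.unlock trmxCK; move: (S^t*) (T^t*) ST' => S' T' ST'.
have -> : diag_mx (\row_i (d i * e i * f i)%:C) = diag_mx (\row_i (d i)%:C)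
   *m diag_mx (\row_i (e i)%:C) *m diag_mx (\row_i (f i)%:C) :> 'M[C]_n.
  rewrite !mulmx_diag; congr diag_mx.
  by apply/rowP => i; rewrite !mxE !rmorphM.
move: (diag_mx (\row_i (d i)%:C)) (diag_mx (\row_i (e i)%:C))
  (diag_mx (\row_i (f i)%:C)) => D E F.
by rewrite !mulmxA -(mulmxA _ S T) ST mulmx1 -(mulmxA _ T' S') ST' mulmx1.
Qed.

Lemma conj_cancel X Y Z : Y *m Z = 1%:M -> Y *m (Z *m X *m Z^t* ) *m Y^t* = X.
Proof. by move=> YZ; rewrite !mulmxA YZ mul1mx -mulmxA -adjM YZ adj1 mulmx1. Qed.

Lemma leo_dg_midpoint S T (p q p' q' : 'I_n -> R) :
  S \in unitmx -> T \in unitmx ->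
  (forall i, 0 < p i) -> (forall i, 0 < q i) ->
  (forall i, 0 < p' i) -> (forall i, 0 < q' i) ->
  dg S p <=o dg T p' -> dg S q <=o dg T q' ->
  pd (dg S p) -> pd (dg T p') ->
  dg S (fun i => Num.sqrt (p i * q i)) <=o dg T (fun i => Num.sqrt (p' i * q' i)).
Proof.
move=> uS uT p0 q0 p0' q0' H1 H2 pA pA'.
set X := dg S _.
have hX : X^t* = X by rewrite dg_herm.
pose s i : R := Num.sqrt (p' i); pose u i : R := Num.sqrt (q' i / p' i).
have s0 i : s i != 0 by rewrite gt_eqF // sqrtr_gt0.
have ss i : s i * s i = p' i by rewrite -expr2 sqr_sqrtr // ltW.
have uu i : u i * u i = q' i / p' i by rewrite -expr2 sqr_sqrtr // ltW // divr_gt0.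
pose Dm (f : 'I_n -> R) := dg (1%:M : 'M[C]_n) f.
have u1 : (1%:M : 'M[C]_n) \is unitarymx by apply/unitarymxP; rewrite adj1 mulmx1.
have hD f : (Dm f)^t* = Dm f by rewrite dg_herm.
have DD f g : Dm f *m Dm g = Dm (fun i => f i * g i) by rewrite dg_mul.
have D1 f : (forall i, f i = 1) -> Dm f = 1%:M.
  by move=> h; rewrite -(dg1 u1); apply: eq_dg.
have dgT f : dg T f = T^t* *m Dm f *m T by rewrite -dg_mulr mul1mx.
pose Y := Dm (fun i => (s i)^-1) *m (invmx T)^t*.
pose Y' := T^t* *m Dm s.
have Y'Y : Y' *m Y = 1%:M.
  rewrite /Y' /Y mulmxA -(mulmxA (T^t* )) DD D1 ?mulmx1; last by move=> i; rewrite divff.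
  by rewrite -adjM mulVmx // adj1.
have TY : T *m Y^t* = Dm (fun i => (s i)^-1).
  by rewrite adjM hD trmxCK mulmxA mulmxV // mul1mx.
have YT : Y *m T^t* = Dm (fun i => (s i)^-1) by rewrite -[LHS]trmxCK adjM trmxCK TY hD.
have Yc f : Y *m dg T f *m Y^t* = Dm (fun i => f i / p' i).
  rewrite dgT !mulmxA YT -!mulmxA TY mulmxA !DD; apply: eq_dg => i.
  by rewrite -ss; field.
pose Z := Y *m X *m Y^t*.
have XZ : X = Y' *m Z *m Y'^t*.
  by rewrite /Z conj_cancel.
have ZD : Z <=o Dm u.
  apply: sqrt_monotone.
  - exact: hD.
  - by rewrite /Z !adjE hX mulmxA.
  - by move=> v; rewrite qf0 qf_dg; apply: sumr_ge0 => i _; rewrite mulr_ge0 ?sqrtr_ge0 ?sqc_ge0.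
  rewrite DD; have -> : Dm (fun i => u i * u i) = Y *m dg T q' *m Y^t*.
    by rewrite Yc; apply: eq_dg => i; rewrite uu.
  apply: (@leo_trans (Y *m dg S q *m Y^t*)); last exact: leo_conj.
  have -> : dg S q = X *m invmx (dg S p) *m X.
    rewrite invmx_dg //; last by move=> i; rewrite gt_eqF.
    rewrite /X (dg_mul_dual _ _ _ (mulmxV uS)); apply: eq_dg => i.
    have : 0 < p i * q i by rewrite mulr_gt0.
    move=> /ltW/sqr_sqrtr; rewrite expr2 => E.
    rewrite mulrAC E mulrAC divff ?mul1r //.
    by rewrite gt_eqF.
  have -> : Z *m Z = (Y *m X) *m (Y^t* *m Y) *m (Y *m X)^t*.
    by rewrite /Z adjM hX !mulmxA.
  have -> : Y *m (X *m invmx (dg S p) *m X) *m Y^t* =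
     (Y *m X) *m invmx (dg S p) *m (Y *m X)^t* by rewrite adjM hX !mulmxA.
  apply: leo_conj.
  have -> : Y^t* *m Y = invmx (dg T p').
    symmetry; apply: invmx_eq.
    have -> : dg T p' *m (Y^t* *m Y) = T^t* *m (Dm p' *m (T *m Y^t*)) *m Y.
      by rewrite dgT !mulmxA.
    rewrite TY DD -[RHS]Y'Y /Y'.
    apply: (congr1 (fun D => T^t* *m D *m Y)); apply: eq_dg => i.
    by rewrite -ss mulfK.
  exact: inv_antitone.
rewrite XZ; have -> : dg T (fun i => Num.sqrt (p' i * q' i)) = Y' *m Dm u *m Y'^t*.
  have -> : Y' *m Dm u *m Y'^t* = T^t* *m (Dm s *m Dm u *m Dm s) *m T.
    by rewrite /Y' adjM trmxCK hD !mulmxA.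
  rewrite !DD -dgT; apply: eq_dg => i.
  rewrite mulrAC ss /u [in RHS]sqrtrM ?ltW // sqrtrV ?ltW // sqrtrM ?ltW //.
  by rewrite -/(s i) -ss; field.
exact: leo_conj.
Qed.

End Order.

Section Convergence.
Variable R : realType.
Local Notation C := (R[i]).
Local Notation "0+" := (at_right (0 : R)) (only parsing).

Lemma cvg_sumr (T I : Type) (F : set_system T) {FF : Filter F} (r : seq I)
  (f : I -> T -> R) (l : I -> R) :
  (forall i, f i p @[p --> F] --> l i) ->
  (\sum_(i <- r) f i p) @[p --> F] --> \sum_(i <- r) l i.
Proof.
move=> H; elim: r => [|i r IH].
  rewrite big_nil; have -> : (fun p => \sum_(i <- [::]) f i p) = fun=> 0.
    by apply/funext => p; rewrite big_nil.
  exact: cvg_cst.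
rewrite big_cons; have -> : (fun p => \sum_(j <- i :: r) f j p) =
    fun p => f i p + \sum_(j <- r) f j p.
  by apply/funext => p; rewrite big_cons.
by apply: cvgD; [exact: H|exact: IH].
Qed.

Variable n : nat.
Implicit Types (X Y Z : R -> 'M[C]_n) (A B E H K : 'M[C]_n).

Definition mcvg X A := forall i j,
  (Re (X p i j) @[p --> 0+] --> Re (A i j)) /\
  (Im (X p i j) @[p --> 0+] --> Im (A i j)).

Lemma mcvg_froP X A : mcvg X A <->
  forall e, 0 < e -> \forall p \near 0+, fro (X p - A) < e.
Proof.
split=> [H e e0|H].
- have : fro (X p - A) @[p --> 0+] --> 0.
    have -> : nbhs (0 : R) = nbhs (\sum_(i < n) \sum_(j < n)
        ((Re (A i j) - Re (A i j)) ^+ 2 + (Im (A i j) - Im (A i j)) ^+ 2)).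
      congr nbhs.
      by rewrite big1 // => i _; rewrite big1 // => j _; rewrite !subrr expr0n addr0.
    have -> : (fun p => fro (X p - A)) = fun p => \sum_i \sum_j
        ((Re (X p i j) - Re (A i j)) ^+ 2 + (Im (X p i j) - Im (A i j)) ^+ 2).
      apply/funext => p; rewrite froE; apply: eq_bigr => i _; apply: eq_bigr => j _.
      by rewrite !mxE /sqc; case: (X p i j) (A i j) => [? ?] [? ?].
    apply: cvg_sumr => i; apply: cvg_sumr => j; have [h1 h2] := H i j.
    have sq (f : R -> R) l : f p @[p --> 0+] --> l ->
      (f p - l) ^+ 2 @[p --> 0+] --> (l - l) ^+ 2.
      move=> h; rewrite expr2; under eq_fun do rewrite expr2.
      by apply: cvgM; apply: cvgB => //; exact: cvg_cst.
    by apply: cvgD; exact: sq.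
  by move=> /cvgr_lt; apply.
- have sm (e x : R) : 0 < e -> x ^+ 2 < e ^+ 2 -> `|x| < e.
    by move=> e0 h; rewrite -(@ltr_pXn2r _ 2) ?nnegrE ?normr_ge0 ?ltW // -normrX ger0_norm ?sqr_ge0.
  move=> i j; split; apply/cvgrPdist_lt => e e0; have e2 : 0 < e ^+ 2 by rewrite exprn_gt0.
  + apply: filterS (H _ e2) => p h; apply: sm => //; apply: le_lt_trans h.
    apply: le_trans (fro_entry _ i j); rewrite !mxE /sqc -sqrrN opprB.
    by case: (X p i j) (A i j) => [? ?] [? ?] /=; rewrite lerDl sqr_ge0.
  + apply: filterS (H _ e2) => p h; apply: sm => //; apply: le_lt_trans h.
    apply: le_trans (fro_entry _ i j); rewrite !mxE /sqc -sqrrN opprB.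
    by case: (X p i j) (A i j) => [? ?] [? ?] /=; rewrite lerDr sqr_ge0.
Qed.

Lemma sqc_norm_lt (z : C) (r : R) : 0 < r -> (`|z| < r%:C) = (sqc z < r ^+ 2).
Proof.
move=> r0; rewrite -(@ltr_pXn2r _ 2) ?nnegrE ?normr_ge0 //; last by rewrite ler0c ltW.
by rewrite -add_Re2_Im2 -rmorphXn /= ltcR.
Qed.

Lemma cvg_mcvg X A : mcvg X A -> X @ 0+ --> A.
Proof.
move=> /mcvg_froP H P [Q QA sQP].
suff h : \forall p \near 0+, forall i j, Q i j (X p i j).
  by apply: filterS h => p h; apply: sQP.
apply: filter_forall => i; apply: filter_forall => j.
have /nbhs_ballP[e /= e0 sb] := QA i j.
have [r re r0] : exists2 r : R, e = r%:C & 0 < r.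
  have /ltW/ger0_real/RRe_real E := e0; exists (Re e); rewrite ?E //.
  by rewrite -ltcR E.
have r2 : 0 < r ^+ 2 by rewrite exprn_gt0.
apply: filterS (H _ r2) => p h; apply: sb.
change (`|A i j - X p i j| < e); rewrite re sqc_norm_lt //.
apply: le_lt_trans h; apply: le_trans (fro_entry _ i j); rewrite !mxE /sqc.
by rewrite -(opprB (X p i j)) !ReN ImN !sqrrN.
Qed.

Lemma mcvg_cvg X A : X @ 0+ --> A -> mcvg X A.
Proof.
move=> H; apply/mcvg_froP => e e0.
pose d := Num.sqrt (e / (n * n).+1%:R).
have d0 : 0 < d by rewrite sqrtr_gt0 divr_gt0.
have hn : nbhs A [set N : 'M[C]_n | forall i j, `|A i j - N i j| < d%:C].
  exists (fun i j => ball (A i j) d%:C) => //.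
    by move=> i j; apply: nbhsx_ballx; rewrite ltcR.
have {}H : \forall p \near 0+, forall i j, `|A i j - X p i j| < d%:C by exact: (H _ hn).
apply: filterS H => p /= h; rewrite froE.
apply: (@le_lt_trans _ _ (\sum_(i < n) \sum_(j < n) d ^+ 2)).
  apply: ler_sum => i _; apply: ler_sum => j _.
  have := h i j; rewrite sqc_norm_lt // => /ltW; rewrite !mxE /sqc.
  by rewrite -(opprB (X p i j)) !ReN ImN !sqrrN.
rewrite !sumr_const card_ord -mulrnA sqr_sqrtr ?divr_ge0 ?ltW //.
by rewrite -[X in X < _]mulr_natr mulrAC ltr_pdivrMr // ltr_pM2l // ltr_nat.
Qed.

Lemma mcvg_cst A : mcvg (fun=> A) A.
Proof. by move=> i j; split; exact: cvg_cst. Qed.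

Lemma mcvgD X Y A B : mcvg X A -> mcvg Y B -> mcvg (fun p => X p + Y p) (A + B).
Proof.
move=> hX hY i j; have [a b] := hX i j; have [c d] := hY i j.
rewrite mxE ReD ImD; split.
  by under eq_fun do rewrite mxE ReD; exact: cvgD.
by under eq_fun do rewrite mxE ImD; exact: cvgD.
Qed.

Lemma mcvgM X Y A B : mcvg X A -> mcvg Y B -> mcvg (fun p => X p *m Y p) (A *m B).
Proof.
move=> hX hY i j; rewrite mxE Re_sum Im_sum; split.
  under eq_fun do rewrite mxE Re_sum; apply: cvg_sumr => k.
  have [a b] := hX i k; have [c d] := hY k j; rewrite ReMc.
  by under eq_fun do rewrite ReMc; apply: cvgB; exact: cvgM.
under eq_fun do rewrite mxE Im_sum; apply: cvg_sumr => k.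
have [a b] := hX i k; have [c d] := hY k j; rewrite ImMc.
by under eq_fun do rewrite ImMc; apply: cvgD; exact: cvgM.
Qed.

Lemma mcvg_scale (f : R -> R) (l : R) X A : f p @[p --> 0+] --> l -> mcvg X A ->
  mcvg (fun p => (f p)%:C *: X p) (l%:C *: A).
Proof.
move=> hf hX i j; have [a b] := hX i j; rewrite mxE ReM ImM; split.
  by under eq_fun do rewrite mxE ReM; exact: cvgM.
by under eq_fun do rewrite mxE ImM; exact: cvgM.
Qed.

Lemma mcvg_near X Y A : (\forall p \near 0+, X p = Y p) -> mcvg X A -> mcvg Y A.
Proof.
move=> XY /mcvg_froP h; apply/mcvg_froP => e e0.
by apply: filterS2 XY (h e e0) => p ->.
Qed.

Lemma mcvg_dg U (f : R -> 'I_n -> R) (g : 'I_n -> R) :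
  (forall i, f p i @[p --> 0+] --> g i) -> mcvg (fun p => dg U (f p)) (dg U g).
Proof.
move=> h i j; rewrite dgE Re_sum Im_sum; split.
  under eq_fun do rewrite dgE Re_sum; apply: cvg_sumr => k; rewrite ReM.
  by under eq_fun do rewrite ReM; apply: cvgMl.
under eq_fun do rewrite dgE Im_sum; apply: cvg_sumr => k; rewrite ImM.
by under eq_fun do rewrite ImM; apply: cvgMl.
Qed.

Definition fo X E H := mcvg (fun p => (p^-1)%:C *: (X p - E)) H.

Lemma right0_gt0 : \forall p \near 0+, 0 < p.
Proof. exact: nbhs_right_gt. Qed.

Lemma cvg_id0 : p @[p --> 0+] --> (0 : R).
Proof. exact: cvg_at_right_filter (@cvg_id _ _). Qed.

Lemma fo_mcvg X E H : fo X E H -> mcvg X E.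
Proof.
move=> h; have := mcvgD (mcvg_cst E) (mcvg_scale cvg_id0 h).
rewrite scale0r addr0; apply: mcvg_near; apply: filterS right0_gt0 => p p0.
by rewrite scalerA -rmorphM divff ?gt_eqF // scale1r addrC subrK.
Qed.

Lemma fo_near X Y E H : (\forall p \near 0+, X p = Y p) -> fo X E H -> fo Y E H.
Proof. by move=> XY; apply: mcvg_near; apply: filterS XY => p ->. Qed.

Lemma fo_cst E : fo (fun=> E) E 0.
Proof.
rewrite /fo; have -> : (fun p : R => (p^-1)%:C *: (E - E)) = fun=> 0.
  by apply/funext => p; rewrite subrr scaler0.
exact: mcvg_cst.
Qed.

Lemma fo_lin E H : fo (fun p => E + p%:C *: H) E H.
Proof.
apply: (@mcvg_near (fun=> H)); last exact: mcvg_cst.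
apply: filterS right0_gt0 => p p0.
by rewrite addrAC subrr add0r scalerA -rmorphM mulVf ?gt_eqF // scale1r.
Qed.

Lemma foD X Y E H E' H' : fo X E H -> fo Y E' H' ->
  fo (fun p => X p + Y p) (E + E') (H + H').
Proof.
move=> h1 h2; have := mcvgD h1 h2; apply: mcvg_near.
by apply: nearW => p; rewrite -scalerDr opprD addrACA.
Qed.

Lemma foZ (c : R) X E H : fo X E H -> fo (fun p => c%:C *: X p) (c%:C *: E) (c%:C *: H).
Proof.
move=> h; apply: (@mcvg_near (fun p => c%:C *: ((p^-1)%:C *: (X p - E)))).
  by apply: nearW => p; rewrite -scalerBr !scalerA [_ * c%:C]mulrC.
exact: (@mcvg_scale (fun=> c) c _ _ (cvg_cst c) h).
Qed.

Lemma foM X Y E H E' H' : fo X E H -> fo Y E' H' ->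
  fo (fun p => X p *m Y p) (E *m E') (H *m E' + E *m H').
Proof.
move=> h1 h2; have := mcvgD (mcvgM h1 (fo_mcvg h2)) (mcvgM (mcvg_cst E) h2).
apply: mcvg_near; apply: nearW => p.
rewrite -scalemxAl -scalemxAr -scalerDr mulmxBl mulmxBr.
by rewrite addrA subrK.
Qed.

Lemma fo_eq X E H E' H' : fo X E H -> E = E' -> H = H' -> fo X E' H'.
Proof. by move=> h <- <-. Qed.

Lemma fro_dg (U : 'M[C]_n) (d : 'I_n -> R) : U \is unitarymx -> fro (dg U d) = \sum_i d i ^+ 2.
Proof.
move=> hU; rewrite -(fro_unitaryl _ hU) -(fro_unitaryr _ hU).
have -> : U *m dg U d *m U^t* = diag_mx (\row_i (d i)%:C).
  move/unitarymxP: hU => hU.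
  by rewrite dg.unlock !mulmxA hU mul1mx -mulmxA hU mulmx1.
rewrite froE; apply: eq_bigr => i _; rewrite (bigD1 i) //= big1 => [|j ji].
  by rewrite !mxE eqxx mulr1n sqc_real addr0.
by rewrite !mxE eq_sym (negbTE ji) mulr0n sqc0.
Qed.

Lemma fro_qf_le A (r : R) v : A^t* = A -> 0 <= r -> fro A <= r ^+ 2 ->
  `|qf A v| <= r * nsq v.
Proof.
move=> /herm_dg[U [d [hU ->]]] r0; rewrite fro_dg // => h.
have dr i : `|d i| <= r.
  rewrite -(@ler_pXn2r _ 2) ?nnegrE // -normrX ger0_norm ?sqr_ge0 //.
  apply: le_trans h; rewrite (bigD1 i) //= lerDl.
  by apply: sumr_ge0 => ? _; rewrite sqr_ge0.
rewrite -(nsq_unitary v hU) qf_dg /nsq mulr_sumr.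
apply: le_trans (ler_norm_sum _ _ _) _; apply: ler_sum => i _.
by rewrite normrM (ger0_norm (sqc_ge0 _)) ler_wpM2r ?sqc_ge0.
Qed.

Lemma qf_le_fro A (r : R) : A^t* = A -> (forall v, `|qf A v| <= r * nsq v) ->
  fro A <= n%:R * r ^+ 2.
Proof.
move=> /herm_dg[U [d [hU ->]]] h; rewrite fro_dg //.
have -> : n%:R * r ^+ 2 = \sum_(i < n) r ^+ 2.
  by rewrite sumr_const card_ord mulr_natl.
apply: ler_sum => i _; have := h (row i U).
rewrite qf_dg_row // nsq_row // mulr1 => dr.
by rewrite -real_normK ?num_real // ler_pXn2r ?nnegrE // (le_trans _ dr).
Qed.

Lemma fo_leo X E H (r : R) : (forall p, 0 < p -> (X p)^t* = X p) ->
  E^t* = E -> H^t* = H -> fo X E H -> 0 < r ->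
  \forall p \near 0+, forall v,
    `|qf (X p) v - (qf E v + p * qf H v)| <= p * r * nsq v.
Proof.
move=> hX hE hH /mcvg_froP h r0; have r2 : 0 < r ^+ 2 by rewrite exprn_gt0.
apply: filterS2 (h _ r2) right0_gt0 => p {}h p0 v.
have hD : ((p^-1)%:C *: (X p - E) - H)^t* = (p^-1)%:C *: (X p - E) - H.
  by rewrite adjD adjN adjZ adjD adjN hX // hE hH.
have := fro_qf_le v hD (ltW r0) (ltW h).
rewrite qfB qfZ qfB => k; rewrite -mulrA -ler_pdivrMl //.
rewrite -[p^-1]gtr0_norm ?invr_gt0 // -normrM; congr (`|_| <= _): k.
by field; rewrite gt_eqF.
Qed.

Lemma mcvg_squeeze X A : (forall p, 0 < p -> (X p)^t* = X p) -> A^t* = A ->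
  (forall r, 0 < r -> \forall p \near 0+, forall v, `|qf (X p - A) v| <= r * nsq v) ->
  mcvg X A.
Proof.
move=> hX hA h; apply/mcvg_froP => e e0.
pose r := Num.sqrt (e / n.+1%:R).
have r0 : 0 < r by rewrite sqrtr_gt0 divr_gt0.
apply: filterS2 (h _ r0) right0_gt0 => p {}h p0.
have hD : (X p - A)^t* = X p - A by rewrite adjD adjN hX // hA.
apply: le_lt_trans (qf_le_fro hD h) _.
rewrite sqr_sqrtr ?divr_ge0 ?ltW // mulrA ltr_pdivrMr // [X in X < _]mulrC.
by rewrite ltr_pM2l // ltr_nat.
Qed.

Lemma fo_squeeze X L U E H : (forall p, 0 < p -> (X p)^t* = X p) ->
  (forall p, 0 < p -> (L p)^t* = L p) -> (forall p, 0 < p -> (U p)^t* = U p) ->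
  E^t* = E -> H^t* = H ->
  (\forall p \near 0+, leo (L p) (X p)) -> (\forall p \near 0+, leo (X p) (U p)) ->
  fo L E H -> fo U E H -> fo X E H.
Proof.
move=> hX hL hU hE hH LX XU fL fU; apply: mcvg_squeeze => // [p p0|r r0].
  by rewrite adjZ adjD adjN hX // hE.
have := fo_leo hL hE hH fL r0; have := fo_leo hU hE hH fU r0.
move=> k1 k2; near=> p => v.
have p0 : 0 < p by near: p; exact: right0_gt0.
have l1 : leo (L p) (X p) by near: p.
have l2 : leo (X p) (U p) by near: p.
have k1' : forall v, `|qf (U p) v - (qf E v + p * qf H v)| <= p * r * nsq v by near: p.
have k2' : forall v, `|qf (L p) v - (qf E v + p * qf H v)| <= p * r * nsq v by near: p.
rewrite qfB qfZ qfB.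
have -> : p^-1 * (qf (X p) v - qf E v) - qf H v =
  p^-1 * (qf (X p) v - (qf E v + p * qf H v)) by field; rewrite gt_eqF.
rewrite normrM gtr0_norm ?invr_gt0 // ler_pdivrMl // mulrA.
have := k1' v; have := k2' v; have := l1 v; have := l2 v.
rewrite !ler_norml => a1 a2 /andP[b1 b2] /andP[c1 c2].
by apply/andP; split; [move: a2 b1; lra|move: a1 c2; lra].
Unshelve. all: by end_near. Qed.

End Convergence.

Section Scalar.
Variable R : realType.
Implicit Types (a c p r s t u x : R).

Lemma powR_exp a x : 0 < x -> x `^ a = expR (a * ln x).
Proof. by move=> x0; rewrite /powR gt_eqF. Qed.

Lemma powR_AM a x : 0 < a < 1 -> 0 < x -> x `^ a <= (1 - a) + a * x.
Proof.
move=> /andP[a0 a1] x0; rewrite powR_exp //; set l := ln x.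
have E : x = expR (a * l) * expR ((1 - a) * l).
  by rewrite -expRD -mulrDl addrCA subrr addr0 mul1r lnK.
have y0 : 0 < expR (a * l) by rewrite expR_gt0.
have h1 : 1 >= expR (a * l) * (1 - a * l).
  have := expR_ge1Dx (- (a * l)); rewrite -(ler_pM2l y0) -expRD subrr expR0.
  by [].
have h2 : x >= expR (a * l) * (1 + (1 - a) * l).
  by rewrite [leRHS]E ler_pM2l // expR_ge1Dx.
have k1 := ler_wpM2l (ltW a0) h2.
have k2 : (1 - a) * (expR (a * l) * (1 - a * l)) <= (1 - a) * 1.
  by rewrite ler_wpM2l // subr_ge0 ltW.
move: k1 k2; move: (expR _) => y; nra.
Qed.

Lemma powR_HM a x : 0 < a < 1 -> 0 < x -> ((1 - a) + a * x^-1)^-1 <= x `^ a.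
Proof.
move=> a01 x0; have x0' : 0 < x^-1 by rewrite invr_gt0.
have := powR_AM a01 x0'; have -> : x^-1 `^ a = (x `^ a)^-1.
  by rewrite !powR_exp // lnV ?posrE // mulrN expRN.
have y0 := powR_gt0 a x0 => h.
by rewrite -[leRHS]invrK lef_pV2 // posrE ?invr_gt0 // (lt_le_trans _ h) // invr_gt0.
Qed.

Lemma powR_absorb a e : 0 < a < 1 -> 0 < e ->
  exists M, forall x, 0 < x -> x `^ a <= e + M * x.
Proof.
move=> a01 e0; pose t := e `^ a^-1; have t0 : 0 < t by rewrite powR_gt0.
have a0 : 0 < a by case/andP: a01.
have ta : t `^ a = e by rewrite /t -powRrM mulVf ?gt_eqF // powRr1 // ltW.
exists (e * a / t) => x x0.
have xt : 0 < x / t by rewrite divr_gt0.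
have := powR_AM a01 xt; rewrite powRM ?invr_ge0 ?(ltW x0) ?(ltW t0) //.
have -> : t^-1 `^ a = e^-1.
  by rewrite -ta !powR_exp ?invr_gt0 // lnV ?posrE // mulrN expRN.
rewrite ler_pdivrMr // => h; apply: le_trans h _.
rewrite mulrDl mulrBl mul1r.
have -> : e * a / t * x = a * (x / t) * e by ring.
by rewrite lerD2r gerBl mulr_ge0 // ltW.
Qed.

Lemma powR_lower2 a x : 0 < a < 1 -> 0 < x ->
  1 + a * (x - 1) - (x - 1) ^+ 2 <= x `^ a.
Proof.
move=> a01 x0; apply: le_trans (powR_HM a01 x0).
case/andP: a01 => a0 a1.
have d0 : 0 < (1 - a) * x + a by rewrite addr_gt0 // mulr_gt0 ?subr_gt0.
have -> : (1 - a + a / x)^-1 = x / ((1 - a) * x + a).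
  by rewrite -[X in _ = X]invrK invf_div; congr (_^-1); field; rewrite gt_eqF.
rewrite ler_pdivlMr //.
have k : 0 <= (x - 1) ^+ 2 by rewrite sqr_ge0.
rewrite -subr_ge0.
have -> : x - (1 + a * (x - 1) - (x - 1) ^+ 2) * ((1 - a) * x + a) =
  (x - 1) ^+ 2 * (a ^+ 2 + (1 - a) * x) by ring.
by rewrite mulr_ge0 // addr_ge0 ?sqr_ge0 // mulr_ge0 // ltW // subr_gt0.
Qed.

Lemma sqr_expN t : 0 <= t -> t ^+ 2 * expR (- t) <= 2.
Proof.
move=> t0; rewrite expRN ler_pdivrMr ?expR_gt0 //.
have := expR_ge1Dxn 1 t0; rewrite (_ : 2`!%:R = 2 :> R) // => h.
by move: h; lra.
Qed.

Lemma proot_approx c : 0 <= c -> exists2 M, 0 <= M & forall p x, 0 < p -> 0 <= x ->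
  x <= 1 + p * c ->
  `|(if 0 < x then x `^ p^-1 else 0) - expR ((x - 1) / p)| <= M * p.
Proof.
move=> c0; pose M := 2 + c ^+ 2 * expR c.
have M2 : 2 <= M by rewrite lerDl mulr_ge0 ?sqr_ge0 ?expR_ge0.
exists (2 * M); first by rewrite mulr_ge0 // (le_trans _ M2).
move=> p x p0 x0 xc; pose t := (1 - x) / p.
have pt : p * t = 1 - x by rewrite /t mulrC divfK ?gt_eqF.
have -> : (x - 1) / p = - t by rewrite /t -mulNr opprB.
have tc : - c <= t by rewrite -(ler_pM2l p0) pt mulrN; move: xc; lra.
have tM : t ^+ 2 * expR (- t) <= M.
  have [t0|t0] := leP 0 t.
    by apply: le_trans (sqr_expN t0) _.
  apply: (@le_trans _ _ (c ^+ 2 * expR c)); last by rewrite lerDr.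
  apply: ler_pM; rewrite ?sqr_ge0 ?expR_ge0 ?ler_expR //; last by move: tc; lra.
  by rewrite -sqrrN ler_pXn2r ?nnegrE //; move: tc t0; lra.
set q := if _ then _ else _.
have q0 : 0 <= q by rewrite /q; case: ifP => // _; rewrite powR_ge0.
have qe : q <= expR (- t).
  rewrite /q; case: ifPn => [x1|_]; last exact: expR_ge0.
  rewrite powR_exp // ler_expR mulrC ler_pdivrMr // mulNr mulrC pt.
  have := @le_ln1Dx _ (x - 1); rewrite (_ : 1 + (x - 1) = x); last by ring.
  move=> h.
  by apply: le_trans (h _) _; move: x1; lra.
rewrite distrC ger0_norm ?subr_ge0 //.
have [x2|x2] := leP 2^-1 x.
  have x1 : 0 < x by move: x2; lra.
  have : expR (- t) * (1 - 2 * p * t ^+ 2) <= q.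
    rewrite /q x1 powR_exp //.
    have h := expR_ge1Dx (- (2 * p * t ^+ 2)).
    apply: le_trans (ler_wpM2l (expR_ge0 _) h) _.
    rewrite -expRD ler_expR [leRHS]mulrC ler_pdivlMr //.
    have := @le_ln1Dx _ (x^-1 - 1); rewrite (_ : 1 + (x^-1 - 1) = x^-1); last by ring.
    rewrite lnV ?posrE // => k.
    have {}k : - ln x <= x^-1 - 1 by apply: k; rewrite ltrBrDr addNr invr_gt0.
    have : (x^-1 - 1) <= p * t + 2 * (p * t) ^+ 2.
      rewrite pt -subr_ge0.
      have -> : 1 - x + 2 * (1 - x) ^+ 2 - (x^-1 - 1) =
         (1 - x) ^+ 2 * (2 * x - 1) / x by field; rewrite gt_eqF.
      apply: divr_ge0 => //; apply: mulr_ge0; first by rewrite sqr_ge0.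
      by move: x2; lra.
    move: k; move: (ln x) (x^-1) => l y; nra.
  move: tM p0; move: (expR _) => E; nra.
have pt2 : 2^-1 < p * t by rewrite pt; move: x2; lra.
have t0 : 0 < t by rewrite -(pmulr_rgt0 _ p0) (lt_trans _ pt2).
apply: (@le_trans _ _ (expR (- t))); first by rewrite gerBl.
apply: (@le_trans _ _ (t^-1)).
  rewrite expRN lef_pV2 ?posrE ?expR_gt0 //.
  by apply: le_trans (expR_ge1Dx t); rewrite lerDr.
rewrite -[t^-1]mul1r ler_pdivrMr //; move: pt2 M2; nra.
Qed.

Lemma exp_inv_lipschitz c r s : 0 <= r -> 0 <= s ->
  `|(if 0 < r then expR (c - r^-1) else 0) - (if 0 < s then expR (c - s^-1) else 0)|
    <= 3 * expR c * `|r - s|.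
Proof.
wlog sr : r s / s <= r.
  move=> H r0 s0; have [/H|/ltW/H] := leP s r; first by apply.
  by move=> /(_ s0 r0); rewrite distrC [`|s - r|]distrC.
move=> r0 s0; have ec := expR_gt0 c.
have [r1|] := ltP 0 r; last first.
  move=> r1; have -> : r = 0 by apply/eqP; rewrite eq_le r1 r0.
  rewrite ifF; last by apply/negbTE; rewrite -leNgt (le_trans sr).
  by rewrite subrr normr0 mulr_ge0 // mulr_ge0 // ltW.
pose u := r^-1; have u0 : 0 < u by rewrite invr_gt0.
have ru : r = u^-1 by rewrite invrK.
have eu1 : expR (- u) * u <= 1.
  rewrite expRN mulrC ler_pdivrMr ?expR_gt0 // mul1r.
  by apply: le_trans (expR_ge1Dx _); rewrite lerDr.
have eu2 := sqr_expN (ltW u0).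
rewrite expRD -/u (ger0_norm (_ : 0 <= r - s)) ?subr_ge0 //.
have [s1|] := ltP 0 s; last first.
  move=> s1; have -> : s = 0 by apply/eqP; rewrite eq_le s1 s0.
  rewrite !subr0 ger0_norm ?mulr_ge0 ?expR_ge0 //.
  rewrite ru -[3 * _ * _]mulrA mulrCA ler_pM2l // ler_pdivlMr //.
  by apply: le_trans eu1 _; lra.
pose w := s^-1; have w0 : 0 < w by rewrite invr_gt0.
have sw : s = w^-1 by rewrite invrK.
have uw : u <= w by rewrite lef_pV2.
rewrite expRD -/w -mulrBr normrM (gtr0_norm ec) -[3 * _ * _]mulrA mulrCA ler_pM2l //.
have ew : expR (- w) <= expR (- u) by rewrite ler_expR lerN2.
rewrite ger0_norm ?subr_ge0 //.
have -> : expR (- w) = expR (- u) * expR (- (w - u)) by rewrite -expRD; congr expR; ring.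
have f1 := expR_ge1Dx (- (w - u)); have f0 := expR_ge0 (- (w - u)).
have d0 : 0 <= w - u by rewrite subr_ge0.
have -> : r - s = (w - u) / (u * w) by rewrite ru sw; field; rewrite !gt_eqF.
rewrite mulrA ler_pdivlMr ?mulr_gt0 //.
have wE : w = u + (w - u) by ring.
rewrite [X in u * X]wE.
move: f1 f0 d0 eu1 eu2; move: (w - u) => d.
move: (expR (- u)) (expR_ge0 (- u)) (expR (- d)) => E E0 F f1 f0 d0 eu1 eu2.
have g1 : u ^+ 2 * E * (1 - F) <= 2 * d.
  have [F1|F1] := leP F 1.
    by apply: ler_pM; rewrite ?mulr_ge0 ?sqr_ge0 ?subr_ge0 //; move: f1; lra.
  apply: (@le_trans _ _ 0); last by rewrite mulr_ge0.
  by apply: mulr_ge0_le0; [rewrite mulr_ge0 ?sqr_ge0|rewrite subr_le0 ltW].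
have g2 : E * u * d * (1 - F) <= d.
  have [F1|F1] := leP F 1.
    rewrite -[leRHS]mulr1; apply: ler_pM; rewrite ?mulr_ge0 ?subr_ge0 ?(ltW u0) //.
      by rewrite -[leRHS]mul1r ler_wpM2r.
    by move: f0; lra.
  apply: (@le_trans _ _ 0); last by [].
  by apply: mulr_ge0_le0; [rewrite !mulr_ge0 ?(ltW u0)|rewrite subr_le0 ltW].
move: g1 g2; lra.
Qed.

End Scalar.

Section KeyLemma.
Variables (R : realType) (n : nat).
Local Notation C := (R[i]).
Local Notation "0+" := (at_right (0 : R)) (only parsing).
Implicit Types (Z : R -> 'M[C]_n) (U V : 'M[C]_n) (e k z w : 'I_n -> R).

(* The resolvent (c + (1 - Z)/p)^-1 is squeezed by [inv_lower_bound] from below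
   and by antitonicity of the inverse from above. *)
Lemma resolvent_squeeze U V e k z (c p r delta : R) :
  U \is unitarymx -> V \is unitarymx ->
  (forall i, e i = 1 \/ e i = 0 /\ k i = 0) ->
  (forall i, k i + 2 <= c) -> 0 < p -> 0 < r <= 1 -> p <= r * delta -> 2 <= c ->
  (forall v, qf (dg U e) v + p * qf (dg U k) v <=
    qf (dg U e *m dg V z *m dg U e) v + p * r * nsq v) ->
  (forall v, qf (dg V z) v <= qf (dg U e) v + p * qf (dg U k) v
     + (1 - delta) * (nsq v - qf (dg U e) v) + p * r * nsq v) ->
  let w i := c + (1 - z i) / p in
  (forall i, 1 <= w i) /\
  fro (dg V (fun i => (w i)^-1) - dg U (fun i => e i / (c - k i))) <= n%:R * r ^+ 2.
Proof.
move=> hU hV ek kc p0 /andP[r0 r1] pr c2 low up w.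
have wq v : qf (dg V w) v = c * nsq v + p^-1 * (nsq v - qf (dg V z) v).
  have -> : dg V w = dg V (fun=> c * 1) + (p^-1)%:C *: (dg V (fun=> 1) - dg V z).
    by rewrite dgN dgD dgZ dgD; apply: eq_dg => i; rewrite /w mulr1 [p^-1 * _]mulrC.
  by rewrite -dgZ qfD !qfZ qfB dg1 // !qf1.
pose y i := c - r - k i + (delta / p) * (1 - e i).
have dp : r^-1 <= delta / p by rewrite ler_pdivlMr // mulrC ler_pdivrMr // mulrC.
have dp1 : 1 <= r^-1 by rewrite invf_ge1.
have yq v : qf (dg U y) v = (c - r) * nsq v - qf (dg U k) v
    + (delta / p) * (nsq v - qf (dg U e) v).
  have -> : dg U y = dg U (fun=> (c - r) * 1) - dg U k +
     (delta / p)%:C *: (dg U (fun=> 1) - dg U e).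
    by rewrite !dgN !dgD dgZ dgD; apply: eq_dg => i; rewrite /y mulr1.
  by rewrite -dgZ qfD qfZ !qfB qfZ dg1 // !qf1.
have y1 i : 1 <= y i.
  rewrite /y; have [->|[-> ->]] := ek i.
    by rewrite subrr mulr0 addr0; have := kc i; move: r1; lra.
  by rewrite !subr0 mulr1; move: r1 dp dp1 c2; lra.
have yw : leo (dg U y) (dg V w).
  move=> v; rewrite yq wq; have := up v.
  have N0 := nsq_ge0 v; rewrite -(ler_pM2l (_ : 0 < p^-1)) ?invr_gt0 // => h.
  have pp : p^-1 * p = 1 by rewrite mulVf ?gt_eqF.
  move: h; rewrite !mulrDr; move: pp; rewrite [delta / p]mulrC; move: (p^-1) => q.
  move: (qf _ _) (qf _ _) (qf _ _) (nsq _) => a b d f pp.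
  have e1 x : q * (p * x) = x by rewrite mulrA pp mul1r.
  have e2 x : q * (p * r * x) = r * x by rewrite !mulrA pp mul1r.
  rewrite e1 e2; lra.
have w1 i : 1 <= w i.
  rewrite -(qf_dg_row w i hV) -(nsq_row i hV); apply: le_trans (yw _).
  rewrite -qf1 -(dg1 hU); exact: ler_qf_dg.
split=> //.
have pdge (x : 'I_n -> R) (X : 'M[C]_n) : X \is unitarymx -> (forall i, 1 <= x i) -> pd (dg X x).
  move=> hX x1; split; first exact: dg_herm.
  exists 1 => // v; rewrite mul1r -qf1 -(dg1 hX); exact: ler_qf_dg.
have w0 i : w i != 0 by rewrite gt_eqF // (lt_le_trans ltr01).
have y0 i : y i != 0 by rewrite gt_eqF // (lt_le_trans ltr01).
pose g i := e i / (c - k i).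
have ck i : 2 <= c - k i by have := kc i; lra.
have upper v : qf (dg V (fun i => (w i)^-1)) v <= qf (dg U g) v + r * nsq v.
  have := inv_antitone (pdge _ _ hU y1) (pdge _ _ hV w1) yw.
  rewrite !invmx_dg_unitary // => /(_ v) h; apply: le_trans h _.
  have -> : qf (dg U g) v + r * nsq v = qf (dg U (fun i => g i + r * 1)) v.
    by rewrite -dgD -dgZ qfD qfZ dg1 // qf1.
  apply: ler_qf_dg => i; rewrite mulr1 /g /y.
  have := ck i; have := kc i.
  have [->|[-> ->]] := ek i => h1 h2.
    rewrite subrr mulr0 addr0.
    have -> : (c - r - k i)^-1 = 1 / (c - k i) + r / ((c - k i) * (c - r - k i)).
      by field; rewrite !gt_eqF //; move: h1 h2 r1; lra.
    rewrite lerD2l ler_pdivrMr; last by rewrite mulr_gt0 //; move: h1 h2 r1; lra.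
    rewrite -[leLHS]mulr1 ler_pM2l //; move: h1 h2 r1; nra.
  rewrite mul0r add0r !subr0 mulr1.
  rewrite -[leRHS]invrK lef_pV2 ?posrE ?invr_gt0 //; last by move: r1 dp dp1 c2; lra.
  by move: r1 dp dp1 c2; lra.
have lower v : qf (dg U g) v - r * nsq v <= qf (dg V (fun i => (w i)^-1)) v.
  have := inv_lower_bound (pdge _ _ hV w1) (dg_herm U g).
  rewrite invmx_dg_unitary // => /(_ v); apply: le_trans.
  rewrite qfB qfD -[X in _ *m _ *m X](dg_herm U g) qf_conj.
  have gP : dg U g *m dg U e = dg U g.
    rewrite dg_mul //; apply: eq_dg => i; rewrite /g.
    by have [->|[-> _]] := ek i; rewrite ?mulr1 ?mul0r.
  set v' := v *m dg U g.
  have vP : v' *m dg U e = v' by rewrite /v' -mulmxA gP.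
  have n1 : nsq v' = qf (dg U e) v'.
    have -> : dg U e = dg U e *m 1%:M *m (dg U e)^t*.
      rewrite mulmx1 dg_herm dg_mul //; apply: eq_dg => i.
      by have [->|[-> _]] := ek i; rewrite ?mulr1 ?mul0r.
    by rewrite qf_conj qf1 vP.
  have z1 : qf (dg V z) v' = qf (dg U e *m dg V z *m dg U e) v'.
    by rewrite -[X in _ *m _ *m X](dg_herm U e) qf_conj vP.
  have lw : qf (dg V w) v' <= qf (dg U (fun i => c * 1 - k i + r * 1)) v'.
    have -> : dg U (fun i => c * 1 - k i + r * 1) =
      c%:C *: dg U (fun=> 1) - dg U k + r%:C *: dg U (fun=> 1).
      by rewrite !dgZ !dgN !dgD.
    rewrite qfD qfB !qfZ dg1 // !qf1 wq z1.
    have := low v'; rewrite -n1 -(ler_pM2l (_ : 0 < p^-1)) ?invr_gt0 // => h.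
    have pp : p^-1 * p = 1 by rewrite mulVf ?gt_eqF.
    move: h pp; rewrite !mulrDr; move: (p^-1) => q.
    move: (qf _ _) (qf _ _) (nsq _) => a b d h pp.
    have e1 x : q * (p * x) = x by rewrite mulrA pp mul1r.
    have e2 x : q * (p * r * x) = r * x by rewrite !mulrA pp mul1r.
    move: h; rewrite e1 e2; lra.
  have : qf (dg V w) v' <= qf (dg U (fun i => g i + r * 1)) v.
    apply: le_trans lw _; rewrite /v' -qf_conj dg_herm !dg_mul //.
    apply: ler_qf_dg => i; rewrite /g !mulr1; have := ck i.
    have [->|[-> ->]] := ek i => h2; last by rewrite !mul0r add0r ltW.
    have -> : 1 / (c - k i) * (c - k i + r) * (1 / (c - k i)) =
       1 / (c - k i) + r / ((c - k i) ^+ 2).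
      by field; rewrite gt_eqF //; move: h2; lra.
    rewrite lerD2l ler_pdivrMr; last by rewrite exprn_gt0 //; move: h2; lra.
    rewrite -[leLHS]mulr1 ler_pM2l //; move: h2; nra.
  have -> : qf (dg U (fun i => g i + r * 1)) v = qf (dg U g) v + r * nsq v.
    by rewrite -dgD -dgZ qfD qfZ dg1 // qf1.
  lra.
apply: qf_le_fro.
  by rewrite adjD adjN !dg_herm.
move=> v; rewrite qfB ler_norml.
by have := upper v; have := lower v; move=> h1 h2; apply/andP; split; lra.
Qed.

Lemma mpow_inv_cvg U e k Z (delta : R) : U \is unitarymx ->
  (forall i, e i = 1 \/ e i = 0 /\ k i = 0) -> 0 < delta ->
  (forall p, 0 < p -> psdmx (Z p)) ->
  (forall r, 0 < r -> \forall p \near 0+, forall v,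
    qf (dg U e) v + p * qf (dg U k) v <=
    qf (dg U e *m Z p *m dg U e) v + p * r * nsq v) ->
  (forall r, 0 < r -> \forall p \near 0+, forall v,
    qf (Z p) v <= qf (dg U e) v + p * qf (dg U k) v
     + (1 - delta) * (nsq v - qf (dg U e) v) + p * r * nsq v) ->
  mcvg (fun p => mpow p^-1 (Z p)) (dg U (fun i => e i * expR (k i))).
Proof.
move=> hU ek d0 hZ low up.
pose c := \sum_i `|k i| + 2.
have kc i : k i + 2 <= c.
  rewrite /c lerD2r (bigD1 i) //=; apply: le_trans (ler_norm _) _.
  by rewrite lerDl sumr_ge0.
have c2 : 2 <= c by rewrite /c lerDr sumr_ge0.
have c0 : 0 <= c by move: c2; lra.
have [M M0 HM] := proot_approx c0.
pose L := 3 * expR c; have L0 : 0 <= L by rewrite mulr_ge0 ?expR_ge0.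
apply/mcvg_froP => t t0.
pose B := n%:R * (2 * M ^+ 2) + 2 * L ^+ 2 * n%:R.
have B0 : 0 <= B by rewrite addr_ge0 ?mulr_ge0 ?sqr_ge0.
pose r := Num.min 1 (t / (B + 1)).
have r0 : 0 < r by rewrite lt_min ltr01 divr_gt0 // ltr_pwDr.
have r1 : r <= 1 by rewrite ge_min lexx.
have rt : B * r ^+ 2 < t.
  have : r <= t / (B + 1) by rewrite ge_min lexx orbT.
  rewrite ler_pdivlMr ?ltr_pwDr // => h.
  have : r ^+ 2 <= r by rewrite expr2 -[leRHS]mulr1 ler_pM2l.
  by move: h r0 B0; nra.
have pd0 : 0 < r * delta by rewrite mulr_gt0.
near=> p.
have p0 : 0 < p by near: p; exact: right0_gt0.
have pr : p <= r by near: p; exact: nbhs_right_ltW.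
have prd : p <= r * delta by near: p; exact: nbhs_right_ltW.
have lowp : forall v, qf (dg U e) v + p * qf (dg U k) v <=
    qf (dg U e *m Z p *m dg U e) v + p * r * nsq v by near: p; exact: low.
have upp : forall v, qf (Z p) v <= qf (dg U e) v + p * qf (dg U k) v
     + (1 - delta) * (nsq v - qf (dg U e) v) + p * r * nsq v by near: p; exact: up.
have [V [z [hV z0 ZV]]] := psd_dgP (hZ p p0).
rewrite ZV in lowp upp *.
have r01 : 0 < r <= 1 by rewrite r0 r1.
have [w1 wfro] := resolvent_squeeze hU hV ek kc p0 r01 prd c2 lowp upp.
rewrite /mpow fcalc_dg //.
pose w i := c + (1 - z i) / p; pose g i := e i / (c - k i).
have ck i : 0 < c - k i by have := kc i; lra.
have pw i j : ((if 0 < z i then z i `^ p^-1 else 0) - e j * expR (k j)) ^+ 2 <=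
   2 * (M * p) ^+ 2 + 2 * L ^+ 2 * ((w i)^-1 - g j) ^+ 2.
  have wi : 1 <= w i := w1 i.
  have zc : z i <= 1 + p * c.
    move: wi; rewrite /w -lerBlDl ler_pdivlMr // => h; move: h p0; nra.
  have h1 := HM p (z i) p0 (z0 i) zc.
  have g0 : 0 <= g j.
    by rewrite /g; have [->|[-> _]] := ek j; rewrite ?mul0r // divr_ge0 // ltW.
  have wi0 : 0 < (w i)^-1 by rewrite invr_gt0 (lt_le_trans ltr01).
  have := exp_inv_lipschitz c (ltW wi0) g0; rewrite wi0 invrK.
  have -> : c - w i = (z i - 1) / p by rewrite /w; field; rewrite gt_eqF.
  have -> : (if 0 < g j then expR (c - (g j)^-1) else 0) = e j * expR (k j).
    rewrite /g; have [->|[-> _]] := ek j; last by rewrite !mul0r ltxx.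
    by rewrite !mul1r invr_gt0 ck invrK; congr expR; ring.
  rewrite -/L; move: h1; move: (expR _) (if _ then _ else _) (e j * _) => m q b.
  move=> h1 h2.
  have k1 : (q - m) ^+ 2 <= (M * p) ^+ 2.
    by rewrite -real_normK ?num_real // ler_pXn2r ?nnegrE ?mulr_ge0 // ltW.
  have k2 : (m - b) ^+ 2 <= L ^+ 2 * ((w i)^-1 - g j) ^+ 2.
    rewrite -real_normK ?num_real // -[X in _ <= _ * X]real_normK ?num_real //.
    by rewrite -exprMn ler_pXn2r ?nnegrE ?mulr_ge0.
  have : 0 <= (q - m - (m - b)) ^+ 2 by rewrite sqr_ge0.
  move: k1 k2; rewrite -mulrA; move: (L ^+ 2 * _) ((M * p) ^+ 2) => x y.
  nra.
apply: le_lt_trans (fro_dg_transfer hV hU pw) _.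
apply: le_lt_trans rt.
have -> : B * r ^+ 2 = n%:R * (2 * (M ^+ 2 * r ^+ 2)) + 2 * L ^+ 2 * (n%:R * r ^+ 2).
  by rewrite /B; ring.
apply: lerD.
  apply: ler_wpM2l => //; apply: ler_wpM2l => //.
  rewrite exprMn; apply: ler_wpM2l; rewrite ?sqr_ge0 //.
  by rewrite ler_pXn2r ?nnegrE // ltW.
apply: ler_wpM2l => //; by rewrite mulr_ge0 ?sqr_ge0.
Unshelve. all: by end_near. Qed.

End KeyLemma.

Section FunctionalCalculus.
Variables (R : realType) (n : nat).
Local Notation C := (R[i]).
Local Notation "0+" := (at_right (0 : R)) (only parsing).
Implicit Types (A B X Y : 'M[C]_n) (U V T : 'M[C]_n) (d e : 'I_n -> R).

Lemma powR_deriv0 (c x : R) : 0 < x ->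
  p^-1 * (x `^ (c * p) - 1) @[p --> 0+] --> c * ln x.
Proof.
move=> x0; set l := c * ln x; apply/cvgrPdist_le => e e0.
have D0 : 0 < 2 * l ^+ 2 + 1 by have := sqr_ge0 l; lra.
near=> p; have p0 : 0 < p by near: p; exact: right0_gt0.
have pl : p * `|l| <= 2^-1.
  have : p <= 2^-1 / (`|l| + 1).
    by near: p; apply: nbhs_right_ltW; rewrite divr_gt0 // ltr_pwDr.
  rewrite ler_pdivlMr ?ltr_pwDr // => h; apply: le_trans h.
  by rewrite ler_pM2l // lerDl.
have pe : 2 * l ^+ 2 * p <= e.
  have : p <= e / (2 * l ^+ 2 + 1).
    by near: p; apply: nbhs_right_ltW; rewrite divr_gt0.
  rewrite ler_pdivlMr // => h; apply: le_trans h.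
  by rewrite mulrC ler_pM2l // lerDl.
rewrite powR_exp // mulrAC -/l; set u := l * p.
have u2 : u <= 2^-1 by apply: le_trans pl; rewrite /u mulrC ler_pM2l // ler_norm.
have h1 := expR_ge1Dx u; have h2 := expR_ge1Dx (- u).
have h3 : expR u <= 1 + u + 2 * u ^+ 2.
  have Eu : expR u * expR (- u) = 1 by rewrite -expRD subrr expR0.
  have : expR u * (1 - u) <= 1 by rewrite -[leRHS]Eu ler_pM2l ?expR_gt0.
  have : 0 <= u ^+ 2 by rewrite sqr_ge0.
  move: u2 h1; move: (expR u) => E; nra.
have -> : l - p^-1 * (expR u - 1) = - (p^-1 * (expR u - 1 - u)).
  by rewrite /u; field; rewrite gt_eqF.
rewrite normrN ger0_norm; last by rewrite mulr_ge0 ?invr_ge0 ?(ltW p0) //; move: h1; lra.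
rewrite ler_pdivrMl //; apply: (@le_trans _ _ (2 * u ^+ 2)); first by move: h3; lra.
rewrite /u; move: pe p0; nra.
Unshelve. all: by end_near. Qed.

Lemma mpow_dg (q : R) U d : U \is unitarymx ->
  mpow q (dg U d) = dg U (fun i => if 0 < d i then d i `^ q else 0).
Proof. by move=> hU; rewrite /mpow fcalc_dg. Qed.

Lemma msupp_dg U d : U \is unitarymx ->
  msupp (dg U d) = dg U (fun i => if d i == 0 then 0 else 1).
Proof. by move=> hU; rewrite /msupp fcalc_dg. Qed.

Lemma mlog_dg U d : U \is unitarymx ->
  mlog (dg U d) = dg U (fun i => if 0 < d i then ln (d i) else 0).
Proof. by move=> hU; rewrite /mlog fcalc_dg. Qed.

Lemma mexp_dg U d : U \is unitarymx ->
  mexp (dg U d) = dg U (fun i => expR (d i)).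
Proof. by move=> hU; rewrite /mexp fcalc_dg. Qed.

Lemma mginv_dg U d : U \is unitarymx ->
  mginv (dg U d) = dg U (fun i => if d i == 0 then 0 else (d i)^-1).
Proof. by move=> hU; rewrite /mginv fcalc_dg. Qed.

Lemma psd_dg_ge0 U d : (forall i, 0 <= d i) -> psdmx (dg U d).
Proof.
move=> d0; apply/psdmxP; split; first exact: dg_herm.
by move=> v; rewrite qf_dg; apply: sumr_ge0 => i _; rewrite mulr_ge0 ?sqc_ge0.
Qed.

Lemma psd_herm A : psdmx A -> A^t* = A.
Proof. by move=> /psdmxP[]. Qed.

Lemma psd_qf_ge0 A v : psdmx A -> 0 <= qf A v.
Proof. by move=> /psdmxP[]. Qed.

Lemma mpow_psd (q : R) A : psdmx A -> psdmx (mpow q A).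
Proof.
move=> /psd_dgP[U [d [hU d0 ->]]]; rewrite mpow_dg //; apply: psd_dg_ge0 => i.
by case: ifP => // _; rewrite powR_ge0.
Qed.

Lemma mginv_psd A : psdmx A -> psdmx (mginv A).
Proof.
move=> /psd_dgP[U [d [hU d0 ->]]]; rewrite mginv_dg //; apply: psd_dg_ge0 => i.
by case: ifP => // _; rewrite invr_ge0.
Qed.

Lemma msupp_psd A : psdmx A -> psdmx (msupp A).
Proof.
move=> /psd_dgP[U [d [hU d0 ->]]]; rewrite msupp_dg //; apply: psd_dg_ge0 => i.
by case: ifP.
Qed.

Lemma mlog_herm A : psdmx A -> (mlog A)^t* = mlog A.
Proof. by move=> /psd_dgP[U [d [hU d0 ->]]]; rewrite mlog_dg // dg_herm. Qed.

Lemma msupp_idem A : psdmx A -> msupp A *m msupp A = msupp A.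
Proof.
move=> /psd_dgP[U [d [hU d0 ->]]]; rewrite msupp_dg // dg_mul //.
by apply: eq_dg => i; case: ifP; rewrite ?mulr0 ?mulr1.
Qed.

Lemma msupp_le1 A : psdmx A -> leo (msupp A) 1%:M.
Proof.
move=> /psd_dgP[U [d [hU d0 ->]]]; rewrite msupp_dg // -(dg1 hU).
by apply: leo_dg => i; case: ifP.
Qed.

Lemma msupp_mpow (q : R) A : psdmx A -> msupp A *m mpow q A = mpow q A.
Proof.
move=> /psd_dgP[U [d [hU d0 ->]]]; rewrite msupp_dg // mpow_dg // dg_mul //.
by apply: eq_dg => i; case: eqP => [->|_]; rewrite ?ltxx ?mulr0 ?mul1r.
Qed.

Lemma msupp_mginv A : psdmx A -> msupp (mginv A) = msupp A.
Proof.
move=> /psd_dgP[U [d [hU d0 ->]]]; rewrite (mginv_dg d hU) (msupp_dg _ hU) (msupp_dg d hU).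
by apply: eq_dg => i; case: (eqVneq (d i) 0) => [_|di]; rewrite ?eqxx // invr_eq0 (negbTE di).
Qed.

Lemma mlog_mginv A : psdmx A -> mlog (mginv A) = - mlog A.
Proof.
move=> /psd_dgP[U [d [hU d0 ->]]]; rewrite mginv_dg // !mlog_dg // dgN.
apply: eq_dg => i; case: (eqVneq (d i) 0) => [->|di]; first by rewrite ltxx oppr0.
have di0 : 0 < d i by rewrite lt_neqAle eq_sym di d0.
by rewrite invr_gt0 di0 lnV ?posrE.
Qed.

Lemma fo_mpow (c : R) A : 0 < c -> psdmx A ->
  fo (fun p => mpow (c * p) A) (msupp A) (c%:C *: mlog A).
Proof.
move=> c0 /psd_dgP[U [d [hU d0 ->]]]; rewrite msupp_dg // mlog_dg // dgZ.
apply: (@mcvg_near _ _ (fun p => dg U (fun i => p^-1 *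
    ((if 0 < d i then d i `^ (c * p) else 0) - (if d i == 0 then 0 else 1))))).
  by apply: nearW => p; rewrite mpow_dg // dgN dgD dgZ.
apply: mcvg_dg => i; case: (eqVneq (d i) 0) => [->|di].
  rewrite ltxx mulr0; have -> : (fun p : R => p^-1 * (0 - 0)) = fun=> 0.
    by apply/funext => p; rewrite subrr mulr0.
  exact: cvg_cst.
have -> : 0 < d i by rewrite lt_neqAle eq_sym di d0.
by apply: powR_deriv0; rewrite lt_neqAle eq_sym di d0.
Qed.

End FunctionalCalculus.

Section Limits.
Variables (R : realType) (n : nat).
Local Notation C := (R[i]).
Local Notation "0+" := (at_right (0 : R)) (only parsing).
Implicit Types (A B L : 'M[C]_n) (X Y : R -> 'M[C]_n).

Lemma qfE A v : qf A v = \sum_i \sum_j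
  (Re (v 0 i * conjC (v 0 j)) * Re (A i j) - Im (v 0 i * conjC (v 0 j)) * Im (A i j)).
Proof.
rewrite qf.unlock mxE Re_sum exchange_big; apply: eq_bigr => j _ /=.
rewrite !mxE mulr_suml Re_sum; apply: eq_bigr => i _.
by rewrite mulrAC ReMc.
Qed.

Lemma mcvg_qf X A v : mcvg X A -> qf (X p) v @[p --> 0+] --> qf A v.
Proof.
move=> h; rewrite qfE; under eq_fun do rewrite qfE.
apply: cvg_sumr => i; apply: cvg_sumr => j; have [h1 h2] := h i j.
by apply: cvgB; apply: cvgMr.
Qed.

Lemma near_cvgr (f g : R -> R) (l : R) : (\forall p \near 0+, f p = g p) ->
  f p @[p --> 0+] --> l -> g p @[p --> 0+] --> l.
Proof.
move=> fg /cvgrPdist_lt h; apply/cvgrPdist_lt => e e0.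
by apply: filterS2 fg (h e e0) => p ->.
Qed.

Lemma mcvg_leo X Y A B : mcvg X A -> mcvg Y B ->
  (\forall p \near 0+, leo (X p) (Y p)) -> leo A B.
Proof.
move=> hX hY h v; have k : qf (Y p) v - qf (X p) v @[p --> 0+] --> qf B v - qf A v.
  by apply: cvgB; exact: mcvg_qf.
rewrite -subr_ge0; apply: (cvgr_to_ge k); apply: filterS h => p /(_ v).
by rewrite /= subr_ge0.
Qed.

Lemma mcvg_herm X A : (\forall p \near 0+, (X p)^t* = X p) -> mcvg X A -> A^t* = A.
Proof.
move=> hX h; apply/matrixP => i j; rewrite !mxE.
have [h1 h2] := h i j; have [k1 k2] := h j i.
have e1 : \forall p \near 0+, Re (X p j i) = Re (X p i j).
  apply: filterS hX => p /matrixP/(_ j i); rewrite !mxE.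
  by case: (X p i j) (X p j i) => [a b] [a' b'] [-> _].
have e2 : \forall p \near 0+, Im (X p j i) = - Im (X p i j).
  apply: filterS hX => p /matrixP/(_ j i); rewrite !mxE.
  by case: (X p i j) (X p j i) => [a b] [a' b'] [_ ->].
have r1 : Re (A j i) = Re (A i j).
  apply: (@cvg_unique _ _ (fmap (fun p => Re (X p j i)) 0+)) => //.
  by apply: near_cvgr h1; apply: filterS e1 => p ->.
have r2 : Im (A j i) = - Im (A i j).
  apply: (@cvg_unique _ _ (fmap (fun p => Im (X p j i)) 0+)) => //.
  by apply: near_cvgr (cvgN h2); apply: filterS e2 => p ->.
have -> (z : C) : conjC z = Complex (Re z) (- Im z) by case: z.
by rewrite r1 r2 opprK; case: (A i j).
Qed.

Lemma monotone_cvg_right0 (f : R -> R) :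
  (forall x y, 0 < x -> x <= y -> f x <= f y) -> (forall x, 0 < x -> 0 <= f x) ->
  exists l : R, f p @[p --> 0+] --> l.
Proof.
move=> fm f0; have h := @nondecreasing_at_right_cvgr R f 0 (BInfty _ false).
eexists; apply: h => //.
- by move=> x y; rewrite !in_itv /= !andbT => x0 y0; exact: fm.
- by exists 0 => _ [x /= + <-]; rewrite in_itv /= andbT; exact: f0.
Qed.

Lemma herm_entry A i j : A^t* = A ->
  let q v := qf A v in
  let u := 'e_i : 'rV[C]_n in let w := 'e_j : 'rV[C]_n in
  Re (A i j) = (q (u + w) - q u - q w) / 2 /\
  Im (A i j) = (q (u + 'i%C *: w) - q u - q ('i%C *: w)) / 2.
Proof.
move=> hA q u w.
have bil (x y : 'rV[C]_n) : qf A (x + y) - qf A x - qf A y =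
    2 * Re ((x *m A *m y^t*) 0 0).
  rewrite qf.unlock adjD !(mulmxDl, mulmxDr) !mxE !ReD.
  have -> : \sum_k (y *m A) 0 k * (x^t*) k 0 = conjC (\sum_k (x *m A) 0 k * (y^t*) k 0).
    have /matrixP/(_ 0 0) : y *m A *m x^t* = (x *m A *m y^t*)^t*.
      by rewrite !adjM trmxCK hA mulmxA.
    by rewrite !mxE.
  have -> (z : C) : Re (conjC z) = Re z by case: z.
  ring.
have ent : (u *m A *m w^t*) 0 0 = A i j.
  rewrite -rowE mxE (bigD1 j) //= big1 => [|k kj].
    by rewrite !mxE !eqxx conjC1 mulr1 addr0.
  by rewrite !mxE (negbTE kj) andbF conjC0 mulr0.
split; rewrite /q bil; first by rewrite ent mulrC mulKf.
have -> : ('i%C *: w)^t* = (conjC 'i%C) *: w^t*.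
  by apply/matrixP => x y; rewrite !mxE rmorphM.
rewrite -scalemxAr mxE ent mulrC mulKf //; case: (A i j) => x y /=; ring.
Qed.

Lemma monotone_mcvg X : (forall p, 0 < p -> (X p)^t* = X p) ->
  (forall p q, 0 < p -> p <= q -> leo (X p) (X q)) ->
  (forall p, 0 < p -> leo 0 (X p)) -> exists L, mcvg X L.
Proof.
move=> hX mX pX.
have ql v : exists l : R, qf (X p) v @[p --> 0+] --> l.
  apply: monotone_cvg_right0 => [x y x0 xy|x x0]; first exact: mX.
  by have := pX _ x0 v; rewrite qf0.
have [l hl] := choice ql.
pose u i := 'e_i : 'rV[C]_n.
exists (\matrix_(i, j) Complex ((l (u i + u j) - l (u i) - l (u j)) / 2)
  ((l (u i + 'i%C *: u j) - l (u i) - l ('i%C *: u j)) / 2)) => i j.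
have comb (x y z : 'rV[C]_n) :
  (qf (X p) x - qf (X p) y - qf (X p) z) / 2 @[p --> 0+] --> (l x - l y - l z) / 2.
  by apply: cvgM; [apply: cvgB; [apply: cvgB|]|exact: cvg_cst].
rewrite mxE /=; split.
  apply: near_cvgr (comb _ _ _).
  by apply: filterS (right0_gt0 R) => p p0; have [-> _] := herm_entry i j (hX p p0).
apply: near_cvgr (comb _ _ _).
by apply: filterS (right0_gt0 R) => p p0; have [_ ->] := herm_entry i j (hX p p0).
Qed.

Lemma monotone_lim X : (forall p, 0 < p -> (X p)^t* = X p) ->
  (forall p q, 0 < p -> p <= q -> leo (X p) (X q)) ->
  (forall p, 0 < p -> leo 0 (X p)) -> mcvg X (lim (X @ 0+)).
Proof.
move=> h1 h2 h3; have [L hL] := monotone_mcvg h1 h2 h3.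
apply: mcvg_cvg; apply: cvgP; exact: cvg_mcvg hL.
Qed.

End Limits.

Section Means.
Variables (R : realType) (n : nat).
Local Notation C := (R[i]).
Local Notation "0+" := (at_right (0 : R)) (only parsing).
Implicit Types (A B L Y : 'M[C]_n) (X : R -> 'M[C]_n).

Lemma pd_bounds (a : R) A B : 0 < a < 1 -> pd A -> pd B ->
  let G := gmean_pd a A B in let H := hmean_pd a A B in
  [/\ G^t* = G, H^t* = H, leo 0 H, leo H G &
      leo G ((1 - a)%:C *: A + a%:C *: B)].
Proof.
move=> a01 pA pB; have [T [d [uT d0 AE BE]]] := pd_congr pA pB.
rewrite AE in pA *; rewrite BE gmean_pd_dg // hmean_pd_dg // !dgZ dgD.
have [a0 a1] := andP a01.
split; rewrite ?dg_herm //.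
- move=> v; rewrite qf0 qf_dg; apply: sumr_ge0 => i _; apply: mulr_ge0; last exact: sqc_ge0.
  rewrite invr_ge0 addr_ge0 ?subr_ge0 ?(ltW a1) // mulr_ge0 ?invr_ge0 ?(ltW a0) //.
  exact: ltW.
- by apply: leo_dg => i; apply: powR_HM.
- by apply: leo_dg => i; rewrite mulr1; apply: powR_AM.
Qed.

Lemma gmean_pd_absorb (a e : R) : 0 < a < 1 -> 0 < e -> exists M : R,
  forall A B, pd A -> pd B -> leo (gmean_pd a A B) (e%:C *: A + M%:C *: B).
Proof.
move=> a01 e0; have [M HM] := powR_absorb a01 e0; exists M => A B pA pB.
have [T [d [uT d0 AE BE]]] := pd_congr pA pB.
rewrite AE in pA *; rewrite BE gmean_pd_dg // !dgZ dgD.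
by apply: leo_dg => i; rewrite mulr1; apply: HM.
Qed.

Lemma pd_dg_pos (U : 'M[C]_n) (d : 'I_n -> R) :
  pd (dg U (fun=> 1)) -> (forall i, 0 < d i) -> pd (dg U d).
Proof.
move=> [hX [c c0 Hc]] d0; split; first exact: dg_herm.
pose m := \big[Num.min/1]_i d i.
have m0 : 0 < m by rewrite /m; elim/big_ind: _ => // u v u0 v0; rewrite lt_min u0.
exists (m * c) => [|v]; first by rewrite mulr_gt0.
rewrite -mulrA; apply: (@le_trans _ _ (m * qf (dg U (fun=> 1)) v)).
  by rewrite ler_pM2l.
rewrite -qfZ dgZ; apply: ler_qf_dg => i; rewrite mulr1.
exact: bigmin_le.
Qed.

Lemma pd1 : pd (1%:M : 'M[C]_n).
Proof. by split; [exact: adj1|exists 1 => // v; rewrite mul1r qf1]. Qed.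

Lemma pd_inv A : pd A -> pd (invmx A).
Proof.
move=> /pd_dg[U [d [hU d0 ->]]]; rewrite invmx_dg_unitary // => [|i]; last by rewrite gt_eqF.
by apply: pd_dg_pos => [|i]; [rewrite dg1 //; exact: pd1|rewrite invr_gt0].
Qed.

Lemma pd_lin (s t : R) A B : pd A -> pd B -> 0 < s -> 0 < t ->
  pd (s%:C *: A + t%:C *: B).
Proof.
move=> [hA [c c0 Hc]] [hB [d d0 Hd]] s0 t0; split.
  by rewrite adjD !adjZ hA hB.
exists (s * c + t * d) => [|v]; first by rewrite addr_gt0 // mulr_gt0.
by rewrite qfD !qfZ mulrDl -!mulrA lerD // ler_pM2l.
Qed.

Lemma hmean_pd_mono (a : R) A B A' B' : 0 < a < 1 ->
  pd A -> pd B -> pd A' -> pd B' -> leo A A' -> leo B B' ->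
  leo (hmean_pd a A B) (hmean_pd a A' B').
Proof.
move=> /andP[a0 a1] pA pB pA' pB' lA lB.
have b0 : 0 < 1 - a by rewrite subr_gt0.
apply: inv_antitone => [||v];
  [by apply: pd_lin => //; exact: pd_inv|by apply: pd_lin => //; exact: pd_inv|].
have := inv_antitone pA pA' lA v; have := inv_antitone pB pB' lB v.
move: (invmx A) (invmx A') (invmx B) (invmx B') => X X' Y Y' hY hX.
by rewrite !qfD !qfZ; apply: lerD; rewrite ler_pM2l.
Qed.

Lemma midpoint_closed (P : R -> Prop) (t : R) : P 0 -> P 1 ->
  (forall x y, P x -> P y -> P ((x + y) / 2)) ->
  (forall x, (forall e, 0 < e -> exists2 y, P y & `|x - y| < e) -> P x) ->
  0 <= t <= 1 -> P t.
Proof.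
move=> P0 P1 Pm Pc /andP[t0 t1].
have bis m : exists x y, [/\ P x, P y, x <= t <= y & y - x = 2^-1 ^+ m].
  elim: m => [|m [x [y [Px Py /andP[xt ty] xy]]]].
    by exists 0, 1; rewrite t0 t1 subr0 expr0.
  have Pxy := Pm _ _ Px Py; have [h|h] := leP t ((x + y) / 2).
    exists x, ((x + y) / 2); split => //; first by rewrite xt h.
    by rewrite exprS -xy; field.
  exists ((x + y) / 2), y; split => //; first by rewrite (ltW h) ty.
  by rewrite exprS -xy; field.
apply: Pc => e e0.
have [m me] : exists m, 2^-1 ^+ m < e.
  have h := @cvg_expr R 2^-1; have : `|2^-1 : R| < 1 by rewrite gtr0_norm ?invr_gt0 //; lra.
  move=> /h /cvgr0_norm_lt /(_ _ e0) [m _ /(_ m (leqnn m)) /=].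
  by exists m; apply: le_lt_trans (ler_norm _) _.
have [x [y [Px _ /andP[xt ty] xy]]] := bis m.
exists x => //; rewrite ger0_norm ?subr_ge0 //; apply: le_lt_trans me.
by rewrite -xy lerD2r.
Qed.

(* The exponents a for which A #_a B <= A' #_a B' form a closed set that
   contains 0 and 1 and is stable under midpoints. *)
Lemma gmean_pd_mono (a : R) A B A' B' : 0 < a < 1 ->
  pd A -> pd B -> pd A' -> pd B' -> leo A A' -> leo B B' ->
  leo (gmean_pd a A B) (gmean_pd a A' B').
Proof.
move=> /andP[a0 a1] pA pB pA' pB'.
have [S [x [uS x0 AE BE]]] := pd_congr pA pB.
have [T [y [uT y0 AE' BE']]] := pd_congr pA' pB'.
rewrite AE in pA *; rewrite AE' in pA' *; rewrite BE BE' !gmean_pd_dg // => lA lB.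
pose P s := leo (dg S (fun i => x i `^ s)) (dg T (fun i => y i `^ s)).
apply: (@midpoint_closed P) => [|||s|]; rewrite /P.
- by rewrite (eq_dg S (fun i => powRr0 (x i))) (eq_dg T (fun i => powRr0 (y i))).
- rewrite (eq_dg S (fun i => powRr1 (ltW (x0 i)))).
  by rewrite (eq_dg T (fun i => powRr1 (ltW (y0 i)))).
- move=> s t hs ht.
  have sq (z : R) : 0 < z -> z `^ ((s + t) / 2) = Num.sqrt (z `^ s * z `^ t).
    move=> z0; rewrite !powR_exp // -expRD.
    have -> : s * ln z + t * ln z = (s + t) / 2 * ln z + (s + t) / 2 * ln z by field.
    by rewrite expRD -expr2 sqrtr_sqr gtr0_norm ?expR_gt0.
  rewrite (eq_dg S (fun i => sq _ (x0 i))) (eq_dg T (fun i => sq _ (y0 i))).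
  by apply: leo_dg_midpoint => // [i|i|i|i||]; rewrite ?powR_gt0 //;
    apply: pd_dg_pos => // i; rewrite powR_gt0.
- move=> hs v.
  pose F (u : R) := \sum_i (y i `^ u) * sqc ((v *m T^t*) 0 i)
     - \sum_i (x i `^ u) * sqc ((v *m S^t*) 0 i).
  have pc (z : R) : 0 < z -> z `^ u @[u --> s] --> z `^ s.
    move=> z0; rewrite powR_exp //; under eq_fun do rewrite powR_exp //.
    have h : u * ln z @[u --> s] --> s * ln z by apply: cvgMl; exact: cvg_id.
    exact: (cvg_comp _ _ h (@continuous_expR R _)).
  have Fc : F u @[u --> s] --> F s.
    by apply: cvgB; apply: cvg_sumr => i; apply: cvgMl; exact: pc.
  rewrite -subr_ge0 !qf_dg -/(F s) leNgt; apply/negP => Fs.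
  have /cvgr_lt/(_ _ Fs)/nbhs_ballP[e /= e0 he] := Fc.
  have [u Pu su] := hs e e0.
  have := he u su; rewrite ltNge => /negP; apply.
  by have := Pu v; rewrite !qf_dg -subr_ge0.
- by rewrite !ltW.
Qed.

End Means.

Lemma mnpowE (R : realType) (n : nat) (q : R) (A : 'M[R[i]]_n) :
  mnpow q A = mpow q (mginv A).
Proof. by []. Qed.

Lemma hmean_pdE (R : realType) (n : nat) (a : R) (A B : 'M[R[i]]_n) :
  hmean_pd a A B = invmx ((1 - a)%:C *: invmx A + a%:C *: invmx B).
Proof. by []. Qed.

(* Otherwise unification unfolds the functional calculus into matrix products. *)
Local Opaque mpow mnpow msupp mginv mlog mexp gmean hmean gmean_pd hmean_pd invmx.

Section PsdMeans.
Variables (R : realType) (n : nat).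
Local Notation C := (R[i]).
Local Notation "0+" := (at_right (0 : R)) (only parsing).
Implicit Types (A B L E H K P Q X Y : 'M[C]_n) (a : R).

Lemma leo_shift A (p q : R) : p <= q -> leo (A + (p%:C)%:M) (A + (q%:C)%:M).
Proof. by move=> pq v; rewrite !qfD !qf_scalar lerD2l ler_wpM2r ?nsq_ge0. Qed.

Lemma mcvg_shift A : mcvg (fun e : R => A + (e%:C)%:M) A.
Proof.
have := mcvgD (mcvg_cst A) (mcvg_scale (@cvg_id0 R) (mcvg_cst 1%:M)).
rewrite scale0r addr0; apply: mcvg_near; apply: nearW => p.
by rewrite scalemx1.
Qed.

Lemma gmean_lim a A B : 0 < a < 1 -> psdmx A -> psdmx B ->
  mcvg (fun e => gmean_pd a (A + (e%:C)%:M) (B + (e%:C)%:M)) (gmean a A B).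
Proof.
move=> a01 pA pB; apply: monotone_lim => [p p0|p q p0 pq|p p0].
- by have [] := pd_bounds a01 (pd_psdD pA p0) (pd_psdD pB p0).
- have q0 := lt_le_trans p0 pq.
  by apply: gmean_pd_mono => //; [exact: pd_psdD..|exact: leo_shift|exact: leo_shift].
- have [_ _ h1 h2 _] := pd_bounds a01 (pd_psdD pA p0) (pd_psdD pB p0).
  exact: leo_trans h1 h2.
Qed.

Lemma hmean_lim a A B : 0 < a < 1 -> psdmx A -> psdmx B ->
  mcvg (fun e => hmean_pd a (A + (e%:C)%:M) (B + (e%:C)%:M)) (hmean a A B).
Proof.
move=> a01 pA pB; apply: monotone_lim => [p p0|p q p0 pq|p p0].
- by have [] := pd_bounds a01 (pd_psdD pA p0) (pd_psdD pB p0).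
- have q0 := lt_le_trans p0 pq.
  by apply: hmean_pd_mono => //; [exact: pd_psdD..|exact: leo_shift|exact: leo_shift].
- by have [] := pd_bounds a01 (pd_psdD pA p0) (pd_psdD pB p0).
Qed.

Lemma gmean_bounds a A B : 0 < a < 1 -> psdmx A -> psdmx B ->
  [/\ psdmx (gmean a A B),
    forall L, (forall e : R, 0 < e ->
      leo L (hmean_pd a (A + (e%:C)%:M) (B + (e%:C)%:M))) -> leo L (gmean a A B)
    & leo (gmean a A B) ((1 - a)%:C *: A + a%:C *: B)].
Proof.
move=> a01 pA pB; have G := gmean_lim a01 pA pB.
have bnd (e : R) (e0 : 0 < e) := pd_bounds a01 (pd_psdD pA e0) (pd_psdD pB e0).
split.
- apply/psdmxP; split.
    by apply: mcvg_herm G; apply: filterS (right0_gt0 R) => e /bnd[].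
  move=> v; rewrite -(qf0 v); apply: (mcvg_leo (mcvg_cst 0) G).
  by apply: filterS (right0_gt0 R) => e /bnd[_ _ h1 h2 _]; exact: leo_trans h1 h2.
- move=> L hL; apply: (mcvg_leo (mcvg_cst L) G).
  by apply: filterS (right0_gt0 R) => e e0; have [_ _ _ h _] := bnd e e0;
    exact: leo_trans (hL e e0) h.
- apply: (mcvg_leo G (mcvgD (mcvg_scale (cvg_cst (1 - a)) (mcvg_shift A))
    (mcvg_scale (cvg_cst a) (mcvg_shift B)))).
  by apply: filterS (right0_gt0 R) => e /bnd[].
Qed.

Lemma hmean_bounds a A B : 0 < a < 1 -> psdmx A -> psdmx B ->
  [/\ psdmx (hmean a A B),
    forall L, (forall e : R, 0 < e ->
      leo L (hmean_pd a (A + (e%:C)%:M) (B + (e%:C)%:M))) -> leo L (hmean a A B)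
    & leo (hmean a A B) ((1 - a)%:C *: A + a%:C *: B)].
Proof.
move=> a01 pA pB; have G := hmean_lim a01 pA pB.
have bnd (e : R) (e0 : 0 < e) := pd_bounds a01 (pd_psdD pA e0) (pd_psdD pB e0).
split.
- apply/psdmxP; split.
    by apply: mcvg_herm G; apply: filterS (right0_gt0 R) => e /bnd[].
  move=> v; rewrite -(qf0 v); apply: (mcvg_leo (mcvg_cst 0) G).
  by apply: filterS (right0_gt0 R) => e /bnd[_ _ h1 h2 _].
- move=> L hL; apply: (mcvg_leo (mcvg_cst L) G).
  by apply: filterS (right0_gt0 R) => e e0; exact: hL.
- apply: (mcvg_leo G (mcvgD (mcvg_scale (cvg_cst (1 - a)) (mcvg_shift A))
    (mcvg_scale (cvg_cst a) (mcvg_shift B)))).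
  by apply: filterS (right0_gt0 R) => e /bnd[_ _ _ h1 h2]; exact: leo_trans h1 h2.
Qed.

Lemma gmean_absorb a A B (e : R) : 0 < a < 1 -> psdmx A -> psdmx B -> 0 < e ->
  exists M : R, leo (gmean a A B) (e%:C *: A + M%:C *: B).
Proof.
move=> a01 pA pB e0; have [M HM] := gmean_pd_absorb n a01 e0; exists M.
apply: (mcvg_leo (gmean_lim a01 pA pB) (mcvgD (mcvg_scale (cvg_cst e) (mcvg_shift A))
    (mcvg_scale (cvg_cst M) (mcvg_shift B)))).
by apply: filterS (right0_gt0 R) => p p0; apply: HM; exact: pd_psdD.
Qed.

Lemma nsq_proj P v : P^t* = P -> P *m P = P -> nsq (v *m P) = qf P v.
Proof.
move=> hP PP; rewrite -qf1 -qf_conj; congr (qf _ v).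
by rewrite mulmx1 hP PP.
Qed.

Lemma compl_proj P : P^t* = P -> P *m P = P ->
  (1%:M - P)^t* = 1%:M - P /\ (1%:M - P) *m (1%:M - P) = 1%:M - P.
Proof.
move=> hP PP; split; first by rewrite adjD adjN adj1 hP.
by rewrite mulmxBr mulmx1 mulmxBl mul1mx PP subrr subr0.
Qed.

Lemma nsq_compl P v : P^t* = P -> P *m P = P ->
  nsq (v *m (1%:M - P)) = nsq v - qf P v.
Proof.
by move=> hP PP; have [hQ QQ] := compl_proj hP PP; rewrite nsq_proj // qfB qf1.
Qed.

Lemma conj_support P M Y : Y *m P = Y -> P *m Y = Y ->
  Y *m M *m Y = Y *m (P *m M *m P) *m Y.
Proof. by move=> YP PY; rewrite !mulmxA YP -(mulmxA _ P) PY. Qed.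

Lemma proj_fix P v : P^t* = P -> P *m P = P -> qf P v = nsq v -> v *m P = v.
Proof.
move=> hP PP E; apply/subr0_eq/nsq_eq0.
have -> : v *m P - v = - (v *m (1%:M - P)) by rewrite mulmxBr mulmx1 opprB.
have := nsq_compl v hP PP; rewrite E subrr => <-.
by rewrite /nsq; apply: eq_bigr => i _; rewrite mxE /sqc ReN ImN !sqrrN.
Qed.

Lemma herm_fixC P Y : P^t* = P -> Y^t* = Y -> Y *m P = Y -> P *m Y = Y.
Proof. by move=> hP hY E; rewrite -[RHS]hY -[in RHS]E adjM hP hY. Qed.

Lemma inv_shift_le (p e : R) A Y : psdmx A -> 0 < e -> Y^t* = Y ->
  Y *m msupp A = Y ->
  leo (Y *m invmx (mpow p A + (e%:C)%:M) *m Y) (Y *m mnpow p A *m Y).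
Proof.
move=> pA e0 hY YP; have PY := herm_fixC (psd_herm (msupp_psd pA)) hY YP.
rewrite (conj_support _ YP PY); apply: leo_conjh => //; rewrite mnpowE.
have [U [d [hU d0 ->]]] := psd_dgP pA.
rewrite mginv_dg // !mpow_dg // msupp_dg //.
have -> : (e%:C)%:M = dg U (fun=> e) :> 'M[C]_n.
  by rewrite -scalemx1 -(dg1 hU) dgZ; apply: eq_dg => i; rewrite mulr1.
rewrite dgD invmx_dg_unitary // => [|i]; last first.
  by rewrite gt_eqF // ltr_wpDl //; case: ifP => // _; rewrite powR_ge0.
rewrite !dg_mul //; apply: leo_dg => i.
case: eqP => [_|/eqP di]; first by rewrite ltxx mulr0.
have di0 : 0 < d i by rewrite lt_neqAle eq_sym di d0.
rewrite mul1r mulr1 invr_gt0 di0 !powR_exp ?invr_gt0 // lnV ?posrE // mulrN expRN.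
by rewrite lef_pV2 ?posrE ?expR_gt0 ?addr_gt0 ?expR_gt0 // lerDl ltW.
Qed.

Lemma qf_conj_lin (s t : R) A B Y v :
  qf (Y *m (s%:C *: A + t%:C *: B) *m Y) v =
  s * qf (Y *m A *m Y) v + t * qf (Y *m B *m Y) v.
Proof. by rewrite mulmxDr mulmxDl -!scalemxAr -!scalemxAl qfD !qfZ. Qed.

Lemma qf_conj_lin_le (s t : R) A B A' B' Y Z v : 0 <= s -> 0 <= t ->
  qf (Y *m A *m Y) v <= qf (Y *m A' *m Y) v ->
  qf (Y *m B *m Y) v <= qf (Y *m B' *m Y) v ->
  qf (Z + Z - Y *m (s%:C *: A' + t%:C *: B') *m Y) v <=
  qf (Z + Z - Y *m (s%:C *: A + t%:C *: B) *m Y) v.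
Proof.
move=> s0 t0 hA hB; rewrite [leLHS]qfB [leRHS]qfB !qf_conj_lin lerD2l lerN2.
by apply: lerD; apply: ler_wpM2l.
Qed.

Lemma hmean_pd_lower a (p e : R) A B Y : 0 < a < 1 -> psdmx A -> psdmx B ->
  0 < e -> Y^t* = Y -> Y *m msupp A = Y -> Y *m msupp B = Y ->
  leo (Y + Y - Y *m ((1 - a)%:C *: mnpow p A + a%:C *: mnpow p B) *m Y)
    (hmean_pd a (mpow p A + (e%:C)%:M) (mpow p B + (e%:C)%:M)).
Proof.
move=> /andP[a0 a1] pA pB e0 hY YA YB; rewrite hmean_pdE.
have b0 : 0 < 1 - a by rewrite subr_gt0.
have pW : pd ((1 - a)%:C *: invmx (mpow p A + (e%:C)%:M)
  + a%:C *: invmx (mpow p B + (e%:C)%:M)).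
  have := pd_inv (pd_psdD (mpow_psd p pB) e0).
  have := pd_inv (pd_psdD (mpow_psd p pA) e0).
  by move=> pX pX'; exact: pd_lin pX pX' b0 a0.
apply: leo_trans (inv_lower_bound pW hY) => v.
have hA := inv_shift_le p pA e0 hY YA v.
have hB := inv_shift_le p pB e0 hY YB v.
exact: (qf_conj_lin_le Y (ltW b0) (ltW a0) hA hB).
Qed.

Lemma lower_coefs a P SA SB LA LB : P *m P = P -> P *m SA = P -> P *m SB = P ->
  let K := (1 - a)%:C *: (P *m LA *m P) + a%:C *: (P *m LB *m P) in
  let W1 := (1 - a)%:C *: SA + a%:C *: SB in
  let W2 := (1 - a)%:C *: - LA + a%:C *: - LB in
  P + P + -1 *: (P *m W1 *m P) = P /\
  K + K + -1 *: ((K *m W1 + P *m W2) *m P + P *m W1 *m K) = K.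
Proof.
move=> PP PA PB K W1 W2.
have KP : K *m P = K.
  by rewrite /K mulmxDl -!scalemxAl -!(mulmxA _ P P) PP.
have PK : P *m K = K.
  by rewrite /K mulmxDr -!scalemxAr !mulmxA PP.
have PW1 : P *m W1 = P.
  rewrite /W1 mulmxDr -!scalemxAr PA PB -scalerDl -rmorphD /= subrK.
  by rewrite scale1r.
have KW1 : K *m W1 = K by rewrite -KP -mulmxA PW1.
have PW2 : P *m W2 *m P = - K.
  rewrite /W2 /K mulmxDr mulmxDl -!scalemxAr -!scalemxAl !(mulmxN, mulNmx).
  by rewrite !scalerN opprD.
move: K W1 W2 KP PK PW1 KW1 PW2 => K W1 W2 KP PK PW1 KW1 PW2.
by rewrite PW1 PP KW1 PK mulmxDl PW2 KP subrr add0r !scaleN1r !addrK.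
Qed.

Lemma conj_diff P Q H (s t : R) :
  (s%:C *: P - t%:C *: Q) *m H *m (s%:C *: P - t%:C *: Q) =
  (s ^+ 2)%:C *: (P *m H *m P) + (t ^+ 2)%:C *: (Q *m H *m Q)
  - (s * t)%:C *: (P *m H *m Q + Q *m H *m P).
Proof.
rewrite mulmxBl -!scalemxAl mulmxBl !mulmxBr -!scalemxAl -!scalemxAr.
rewrite !scalerA -!rmorphM /= -!expr2 [t * s]mulrC.
move: ((s ^+ 2)%:C) ((t ^+ 2)%:C) ((s * t)%:C) => x y z.
by mxlin.
Qed.

Lemma fo_lower a A B P : psdmx A -> psdmx B -> P^t* = P -> P *m P = P ->
  P *m msupp A = P -> P *m msupp B = P ->
  let K := (1 - a)%:C *: (P *m mlog A *m P) + a%:C *: (P *m mlog B *m P) in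
  let Y p := P + p%:C *: K in
  fo (fun p => Y p + Y p -
     Y p *m ((1 - a)%:C *: mnpow p A + a%:C *: mnpow p B) *m Y p) P K.
Proof.
move=> pA pB hP PP PA PB K Y.
have AP := herm_fixC (psd_herm (msupp_psd pA)) hP PA.
have BP := herm_fixC (psd_herm (msupp_psd pB)) hP PB.
have fN X : psdmx X -> fo (fun p => mnpow p X) (msupp X) (- mlog X).
  move=> pX; have := fo_mpow ltr01 (mginv_psd pX).
  rewrite msupp_mginv // mlog_mginv // scale1r; apply: fo_near.
  by apply: nearW => p; rewrite mul1r.
have fY : fo Y P K by exact: fo_lin.
have fYY := foD fY fY.
have fW := foD (foZ (1 - a) (fN _ pA)) (foZ a (fN _ pB)).
have := foD fYY (foZ (-1) (foM (foM fY fW) fY)); rewrite !rmorphN !rmorph1.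
have [e1 e2] := lower_coefs a (mlog A) (mlog B) PP PA PB.
move=> h; apply: fo_near (fo_eq h e1 e2).
by apply: nearW => p; rewrite scaleN1r.
Qed.

Lemma herm_bound H : H^t* = H -> exists2 c : R, 0 <= c &
  forall v, `|qf H v| <= c * nsq v.
Proof.
move=> hH; have f0 := fro_ge0 H; exists (1 + fro H); first by rewrite addr_ge0.
move=> v; apply: fro_qf_le => //; first by rewrite addr_ge0.
by move: f0; nra.
Qed.

Lemma offdiag_bound H P (r : R) : H^t* = H -> P^t* = P -> P *m P = P -> 0 < r ->
  exists2 M : R, 0 <= M & forall v,
  qf H v <= qf (P *m H *m P) v + r * nsq v + M * (nsq v - qf P v).
Proof.
move=> hH hP PP r0; have [c c0 Hc] := herm_bound hH.
pose s := Num.sqrt (r / (2 * c + 1)).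
have D0 : 0 < 2 * c + 1 by move: c0; lra.
have s0 : 0 < s by rewrite sqrtr_gt0 divr_gt0.
have ss : s ^+ 2 * (2 * c) <= r.
  rewrite sqr_sqrtr ?divr_ge0 ?(ltW r0) ?(ltW D0) // mulrAC ler_pdivrMr // ler_pM2l //.
  by rewrite lerDl.
pose t := s^-1; have st : s * t = 1 by rewrite /t divff ?gt_eqF.
exists (c + t ^+ 2 * (2 * c)).
  by rewrite addr_ge0 // mulr_ge0 ?sqr_ge0 // mulr_ge0.
move=> v; pose Q : 'M[C]_n := 1%:M - P.
have hQ : Q^t* = Q by rewrite !adjE hP.
have PQ : P *m Q = 0 by rewrite mulmxBr mulmx1 PP subrr.
have QP : Q *m P = 0 by rewrite mulmxBl mul1mx PP subrr.
have QQ : Q *m Q = Q by rewrite {2}/Q mulmxBr mulmx1 QP subr0.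
have IPQ : P + Q = 1%:M by rewrite /Q addrC subrK.
pose x := v *m P; pose y := v *m Q.
have nx : nsq x = qf P v.
  exact: nsq_proj.
have ny : nsq y = nsq v - qf P v.
  exact: nsq_compl.
have hx : qf (P *m H *m P) v = qf H x by rewrite -{2}hP qf_conj.
have hy : qf (Q *m H *m Q) v = qf H y by rewrite -{2}hQ qf_conj.
pose S := s%:C *: P - t%:C *: Q.
have key : qf (S *m H *m S^t*) v + c * nsq (v *m S) =
   (s ^+ 2 * qf H x + t ^+ 2 * qf H y
   - qf (P *m H *m Q + Q *m H *m P) v) + c * (s ^+ 2 * nsq x + t ^+ 2 * nsq y).
  have hS : S^t* = S by rewrite /S adjD adjN !adjZ hP hQ.
  congr (_ + _); last first.
    rewrite -qf1 -qf_conj mulmx1 hS.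
    have -> : S *m S = (s ^+ 2)%:C *: P + (t ^+ 2)%:C *: Q.
      have := conj_diff P Q 1%:M s t; rewrite !mulmx1 PQ QP PP QQ addr0 scaler0 subr0.
      by [].
    rewrite qfD !qfZ nx ny; congr (c * (_ + _ * _)).
    by rewrite /Q qfB qf1.
  rewrite -hx -hy -!qfZ -qfD -qfB hS; congr qf.
  by rewrite /S conj_diff st scale1r.
have dec : qf H v = qf H x + qf H y + qf (P *m H *m Q + Q *m H *m P) v.
  rewrite -hx -hy -!qfD; congr (qf _ v); clearbody Q.
  rewrite -[LHS]mul1mx -[LHS]mulmx1 -IPQ !mulmxDl !mulmxDr.
  by mxlin.
have pos : 0 <= qf (S *m H *m S^t*) v + c * nsq (v *m S).
  rewrite qf_conj; have := Hc (v *m S); rewrite ler_norml => /andP[h _].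
  by move: (qf H _) (nsq _) h => a b; lra.
have := Hc x; have := Hc y; rewrite !ler_norml => /andP[_ y1] /andP[_ x1].
have nxv : nsq x <= nsq v by rewrite -subr_ge0 nx -ny nsq_ge0.
have nx0 := nsq_ge0 x.
have x2 : s ^+ 2 * qf H x <= s ^+ 2 * (c * nsq x) by rewrite ler_wpM2l ?sqr_ge0.
have y2 : t ^+ 2 * qf H y <= t ^+ 2 * (c * nsq y) by rewrite ler_wpM2l ?sqr_ge0.
have x3 : s ^+ 2 * (2 * c) * nsq x <= r * nsq v.
  by apply: ler_pM => //; rewrite mulr_ge0 ?sqr_ge0 ?mulr_ge0.
rewrite hx -ny dec.
move: pos; rewrite key; move: (qf H x) (qf H y) (qf _ v) x2 y2 x3 y1 => a b d.
by move: (nsq x) (nsq y) (nsq v) => e f g; lra.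
Qed.

Lemma fo_upper (X0 : R -> 'M[C]_n) E H P (delta r : R) :
  (forall p, 0 < p -> (X0 p)^t* = X0 p) -> E^t* = E -> H^t* = H -> P^t* = P ->
  P *m P = P -> fo X0 E H -> 0 < delta -> 0 < r ->
  (forall v, qf E v <= qf P v + (1 - 2 * delta) * (nsq v - qf P v)) ->
  \forall p \near 0+, forall v,
   qf (X0 p) v <= qf P v + p * qf (P *m H *m P) v
     + (1 - delta) * (nsq v - qf P v) + p * r * nsq v.
Proof.
move=> hX hE hH hP PP fX d0 r0 EP.
have r2 : 0 < r / 2 by rewrite divr_gt0.
have [M M0 HM] := offdiag_bound hH hP PP r2.
have D0 : 0 < M + 1 by rewrite ltr_wpDl.
have := fo_leo hX hE hH fX r2; move=> fl; near=> p => v.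
have p0 : 0 < p by near: p; exact: right0_gt0.
have pM : p * M <= delta.
  have : p <= delta / (M + 1) by near: p; apply: nbhs_right_ltW; rewrite divr_gt0.
  by rewrite ler_pdivlMr //; move: p0; lra.
have : forall v, `|qf (X0 p) v - (qf E v + p * qf H v)| <= p * (r / 2) * nsq v by near: p.
move=> /(_ v); rewrite ler_norml => /andP[_ h1].
have h2 : p * qf H v <= p * (qf (P *m H *m P) v + r / 2 * nsq v + M * (nsq v - qf P v)).
  by rewrite ler_pM2l.
have h3 := EP v.
have n0 : 0 <= nsq v - qf P v.
  by rewrite -nsq_compl // nsq_ge0.
have h4 : p * M * (nsq v - qf P v) <= delta * (nsq v - qf P v) by rewrite ler_wpM2r.
move: h1 h2 h3 h4; move: (qf (P *m H *m P) v) (qf H v) => k h.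
move: (nsq v) n0 (qf P v) (qf E v) (qf (X0 p) v) => N n0 e x q.
lra.
Unshelve. all: by end_near. Qed.

Lemma spectral_gap E P : E^t* = E -> P^t* = P -> P *m P = P -> P *m E = P ->
  leo E 1%:M -> (forall v, qf E v = nsq v -> v *m P = v) ->
  exists2 delta : R, 0 < delta &
    forall v, qf E v <= qf P v + (1 - 2 * delta) * (nsq v - qf P v).
Proof.
move=> hE hP PP PE E1 fixE.
have EPh : (E - P)^t* = E - P by rewrite adjD adjN hE hP.
have [V [l [hV EV]]] := herm_dg EPh.
have Pq w : qf P w = nsq (w *m P) by rewrite nsq_proj.
have l1 i : l i < 1.
  rewrite -(qf_dg_row l i hV) -EV qfB ltNge; apply/negP => h.
  have n1 := nsq_row i hV.
  have := E1 (row i V); rewrite qf1 n1 => e1.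
  have p0 : 0 <= qf P (row i V) by rewrite Pq nsq_ge0.
  have f : row i V *m P = row i V.
    by apply: fixE; rewrite n1; apply/eqP; rewrite eq_le e1 /=; move: h p0; lra.
  by move: h e1; rewrite Pq f n1; lra.
pose m := \big[Num.max/0]_i l i.
have m1 : m < 1 by rewrite /m; elim/big_ind: _ => // x y x1 y1; rewrite gt_max x1.
exists ((1 - m) / 2); first by rewrite divr_gt0 // subr_gt0.
move=> v; pose Q : 'M[C]_n := 1%:M - P.
have hQ : Q^t* = Q by rewrite !adjE hP.
have EP : E *m P = P := herm_fixC hE hP PE.
have -> : nsq v - qf P v = nsq (v *m Q) by rewrite nsq_compl.
have -> : 1 - 2 * ((1 - m) / 2) = m by field.
rewrite -lerBlDl -qfB.
have -> : E - P = Q *m (E - P) *m Q^t*.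
  rewrite hQ /Q !(mulmxBr, mulmxBl) !mulmx1 !mul1mx PE PP EP PP.
  by rewrite !subrr !subr0.
rewrite qf_conj EV -qf1 -(dg1 hV) -qfZ dgZ; apply: ler_qf_dg => i; rewrite mulr1.
exact: le_bigmax.
Qed.

End PsdMeans.

Section MeanLimit.
Variables (R : realType) (n : nat).
Local Notation C := (R[i]).
Local Notation "0+" := (at_right (0 : R)) (only parsing).
Implicit Types (A B E H K P Q U : 'M[C]_n) (a : R).

Lemma row_ext P Q : (forall v : 'rV[C]_n, v *m P = v *m Q) -> P = Q.
Proof. by move=> h; apply/row_matrixP => i; rewrite !rowE h. Qed.

Lemma herm_trig_diag H : H^t* = H -> (forall i j : 'I_n, (i < j)%N -> H i j = 0) ->
  diag_mx (\row_i (Re (H i i))%:C) = H.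
Proof.
move=> hH tH; have cH i j : H i j = conjC (H j i) by rewrite -{1}hH !mxE.
apply/matrixP => i j; rewrite !mxE; case: (ltngtP i j) => [ij|ji|/val_inj ->].
- by rewrite (tH _ _ ij); case: (eqVneq i j) => [E|_];
    [rewrite E ltnn in ij|rewrite mulr0n].
- by rewrite [RHS]cH (tH _ _ ji) conjC0; case: (eqVneq i j) => [E|_];
    [rewrite E ltnn in ji|rewrite mulr0n].
- by rewrite eqxx mulr1n RRe_real //; apply/CrealP; rewrite -cH.
Qed.

Lemma herm_trig_dg U H : U \is unitarymx -> H^t* = H -> similar_trig U H ->
  exists d, H = dg U d.
Proof.
move=> hU hH; rewrite /similar_to conjymx //; set T := U *m H *m U^t* => /is_trig_mxP tT.
have hT : T^t* = T by rewrite /T !adjE hH mulmxA.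
exists (fun i => Re (T i i)); rewrite dg.unlock herm_trig_diag //.
by move/unitaryP: hU => UU; rewrite /T !mulmxA UU mul1mx -mulmxA UU mulmx1.
Qed.

Lemma proj_codiag P K : P^t* = P -> P *m P = P -> K^t* = K -> P *m K = K ->
  exists U e k, [/\ U \is unitarymx,
    forall i, e i = 1 \/ e i = 0 /\ k i = 0, P = dg U e & K = dg U k].
Proof.
move=> hP PP hK PK; have KP : K *m P = K by rewrite -[RHS]hK -[in RHS]PK adjM hP hK.
have [|U hU /andP[tP tK]] := @cotrigonalization2 C n P K; first by rewrite PK KP.
have [e eP] := herm_trig_dg hU hP tP; have [k kK] := herm_trig_dg hU hK tK.
exists U, e, k; split => // i.
have ee : e i * e i = e i.
  by rewrite -[RHS](qf_dg_row e i hU) -[LHS](qf_dg_row (fun i => e i * e i) i hU) -dg_mul // -eP PP.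
have ek : e i * k i = k i.
  by rewrite -[RHS](qf_dg_row k i hU) -[LHS](qf_dg_row (fun i => e i * k i) i hU)
    -dg_mul // -eP -kK PK.
have : e i * (e i - 1) = 0 by rewrite mulrBr ee mulr1 subrr.
move/eqP; rewrite mulf_eq0 subr_eq0 => /orP[/eqP e0|/eqP ->]; last by left.
by right; split=> //; rewrite -ek e0 mul0r.
Qed.

Lemma fo_conj P (X : R -> 'M[C]_n) E H : fo X E H ->
  fo (fun p => P *m X p *m P) (P *m E *m P) (P *m H *m P).
Proof.
move=> h; apply: fo_eq (foM (foM (fo_cst P) h) (fo_cst P)) _ _ => //.
by rewrite mul0mx add0r mulmx0 addr0.
Qed.

Lemma mean_limit P E H (L X Z : R -> 'M[C]_n) :
  P^t* = P -> P *m P = P -> E^t* = E -> H^t* = H -> P *m E = P ->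
  leo E 1%:M -> (forall v, qf E v = nsq v -> v *m P = v) ->
  (forall p, 0 < p -> psdmx (Z p)) ->
  (forall p, 0 < p -> (L p)^t* = L p) -> (forall p, 0 < p -> (X p)^t* = X p) ->
  (forall p, 0 < p -> leo (L p) (Z p)) -> (forall p, 0 < p -> leo (Z p) (X p)) ->
  fo (fun p => P *m L p *m P) P (P *m H *m P) -> fo X E H ->
  mcvg (fun p => mpow p^-1 (Z p)) (P *m mexp (P *m H *m P)).
Proof.
move=> hP PP hE hH PE E1 fixE pZ hL hX LZ ZX fL fX.
set K := P *m H *m P in fL *.
have hK : K^t* = K by rewrite /K !adjM hP hH mulmxA.
have PK : P *m K = K by rewrite /K !mulmxA PP.
have [U [e [k [hU ek eP kK]]]] := proj_codiag hP PP hK PK.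
have [delta d0 gap] := spectral_gap hE hP PP PE E1 fixE.
have -> : P *m mexp K = dg U (fun i => e i * expR (k i)).
  by rewrite kK mexp_dg // eP dg_mul.
apply: (mpow_inv_cvg hU ek d0 pZ) => r r0; rewrite -eP -kK.
  have hh p : 0 < p -> (P *m L p *m P)^t* = P *m L p *m P.
    by move=> p0; rewrite !adjM hP hL // mulmxA.
  have fl := fo_leo hh hP hK fL r0; apply: filterS2 fl (right0_gt0 R) => p fl p0 v.
  have := fl v; rewrite ler_norml => /andP[h _].
  have := leo_conjh hP (LZ p p0) v; move: h; lra.
have := fo_upper hX hE hH hP PP fX d0 r0 gap.
move=> fu; apply: filterS2 fu (right0_gt0 R) => p fu p0 v.
exact: le_trans (ZX p p0 v) (fu v).
Qed.

Lemma meet_fix P Q X : P^t* = P -> P *m P = P -> Q^t* = Q -> Q *m Q = Q ->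
  is_meet_proj P Q X ->
  [/\ X^t* = X, X *m X = X, X *m P = X, X *m Q = X &
      forall v : 'rV[C]_n, v *m P = v -> v *m Q = v -> v *m X = v].
Proof.
move=> hP PP hQ QQ [/hermP hX XX XE].
have /andP[/andP[XPQ XPQ'] _] : (X^T <= P^T :&: Q^T <= X^T)%MS && true by rewrite andbT.
have sub Y : Y^t* = Y -> Y *m Y = Y -> (X^T <= Y^T)%MS -> X *m Y = X.
  move=> hY YY /submxP[D XD].
  have YX : Y *m X = X.
    by rewrite -[X in Y *m X]trmxK -[RHS]trmxK XD trmx_mul trmxK mulmxA YY.
  by have := congr1 (fun M => M^t*) YX; rewrite adjM hX hY.
have [XP XQ] : (X^T <= P^T)%MS /\ (X^T <= Q^T)%MS.
  by apply/andP; rewrite -sub_capmx.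
split=> //; [exact: sub|exact: sub|] => v vP vQ.
have fx Y : Y^t* = Y -> v *m Y = v -> ((v^t*)^T <= Y^T)%MS.
  by move=> hY vY; apply/submxP; exists ((v^t*)^T); rewrite -trmx_mul -{1}hY -adjM vY.
have /submxP[D DE] : ((v^t*)^T <= X^T)%MS.
  by apply: submx_trans XPQ'; rewrite sub_capmx fx //; exact: fx.
have E : v^t* = X *m D^T by rewrite -[LHS]trmxK DE trmx_mul trmxK.
have Xv : X *m v^t* = v^t* by rewrite E mulmxA XX.
by have := congr1 (fun M => M^t*) Xv; rewrite adjM trmxCK hX.
Qed.

Lemma qf_proj_le P v : P^t* = P -> P *m P = P -> qf P v <= nsq v.
Proof. by move=> hP PP; rewrite -subr_ge0 -nsq_compl // nsq_ge0. Qed.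

Lemma meet_proj_spec P Q : P^t* = P -> P *m P = P -> Q^t* = Q -> Q *m Q = Q ->
  is_meet_proj P Q (meet_proj P Q).
Proof.
move=> hP PP hQ QQ; apply: ClassicalEpsilon.epsilon_spec.
have hPQ : (P + Q)^t* = P + Q by rewrite adjD hP hQ.
have [U [d [hU E]]] := herm_dg hPQ.
pose X := dg U (fun i => if d i == 2 then 1 else 0).
have hX : X^t* = X by rewrite dg_herm.
have XX : X *m X = X.
  by rewrite dg_mul //; apply: eq_dg => i; case: ifP; rewrite ?mulr1 ?mulr0.
have X2 : X *m (P + Q) = 2%:C *: X.
  rewrite E dg_mul // dgZ; apply: eq_dg => i.
  by case: eqP => [->|_]; rewrite ?mul1r ?mulr1 ?mul0r ?mulr0.
have qX v : qf (P + Q) (v *m X) = 2 * nsq (v *m X).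
  by rewrite nsq_proj // -qf_conj X2 -scalemxAl qfZ hX XX.
have XP : X *m P = X.
  apply: row_ext => v; rewrite mulmxA; apply: proj_fix => //.
  have := qX v; rewrite qfD; have := qf_proj_le (v *m X) hP PP.
  by have := qf_proj_le (v *m X) hQ QQ; lra.
have XQ : X *m Q = X.
  apply: row_ext => v; rewrite mulmxA; apply: proj_fix => //.
  have := qX v; rewrite qfD; have := qf_proj_le (v *m X) hP PP.
  by have := qf_proj_le (v *m X) hQ QQ; lra.
exists X; split => //; first exact/hermP.
have PX := herm_fixC hP hX XP; have QX := herm_fixC hQ hX XQ.
apply/andP; split.
  by rewrite sub_capmx; apply/andP; split; apply/submxP; exists (X^T);
    rewrite -trmx_mul ?PX ?QX.
apply/rV_subP => u; rewrite sub_capmx => /andP[uP uQ].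
have fx Y : Y^t* = Y -> Y *m Y = Y -> (u <= Y^T)%MS -> (u^T)^t* *m Y = (u^T)^t*.
  move=> hY YY /submxP[D ->].
  by rewrite trmx_mul trmxK adjM hY -mulmxA YY.
set v := (u^T)^t*; have vP : v *m P = v by exact: fx.
have vQ : v *m Q = v by exact: fx.
have vX : v *m X = v.
  pose g i := if d i == 2 then 0 else (d i - 2)^-1.
  have XE : X = 1%:M - (dg U d - dg U (fun=> 2 * 1)) *m dg U g.
    rewrite -(dg1 hU) !dgN dgD dg_mul // dgN dgD; apply: eq_dg => i; rewrite /g.
    case: eqP => [|/eqP di]; first by rewrite mulr0 subr0.
    by rewrite mulr1 divff ?subrr // subr_eq0.
  rewrite XE mulmxBr mulmx1 mulmxA mulmxBr -dgZ dg1 // -E mulmxDr vP vQ.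
  have -> : 2%:C = 1 + 1 :> C by rewrite rmorph_nat.
  by rewrite scalerDl scale1r mulmxDr mulmx1 subrr mul0mx subr0.
apply/submxP; exists u; rewrite -[LHS]trmxK -[u in RHS]trmxK -trmx_mul; congr (_^T).
have uv : u^T = v^t* by rewrite trmxCK.
by rewrite uv -[X]hX -adjM vX.
Qed.

Lemma psd_conjh (X Y : 'M[C]_n) : Y^t* = Y -> psdmx X -> psdmx (Y *m X *m Y).
Proof.
move=> hY /psdmxP[hX pX]; apply/psdmxP; split; first by rewrite !adjM hX hY mulmxA.
by move=> v; rewrite -{2}hY qf_conj.
Qed.

Lemma psd_null (X : 'M[C]_n) (w : 'rV[C]_n) : psdmx X -> qf X w = 0 -> w *m X = 0.
Proof.
move=> /psd_dgP[U [d [hU d0 ->]]].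
have -> : dg U d = dg U (fun i => Num.sqrt (d i)) *m dg U (fun i => Num.sqrt (d i)).
  by rewrite dg_mul //; apply: eq_dg => i; rewrite -expr2 sqr_sqrtr.
have := dg_herm U (fun i => Num.sqrt (d i)); move: (dg U _) => Y hY.
have -> : Y *m Y = Y *m 1%:M *m Y^t* by rewrite mulmx1 hY.
by rewrite qf_conj qf1 => /nsq_eq0; rewrite mulmx1 mulmxA => ->; rewrite mul0mx.
Qed.

Lemma loewner_proj P Q : P^t* = P -> P *m P = P -> Q^t* = Q -> Q *m Q = Q ->
  loewner_le Q P -> Q *m P = Q.
Proof.
move=> hP PP hQ QQ /psdmxP[_ h].
have PQ : (1%:M - P) *m Q = 0.
  apply: row_ext => v; rewrite mulmx0 mulmxA; apply: nsq_eq0.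
  rewrite nsq_proj //; set w := v *m _.
  have wP : qf P w = 0.
    rewrite -nsq_proj // /w -mulmxA mulmxBl mul1mx PP subrr mulmx0 /nsq.
    by rewrite big1 // => i _; rewrite mxE sqc0.
  apply/eqP; rewrite eq_le; apply/andP; split; last by rewrite -nsq_proj // nsq_ge0.
  by have := h w; rewrite qfB wP sub0r oppr_ge0.
have {}PQ : P *m Q = Q by apply/esym/subr0_eq; rewrite -[X in X - _]mul1mx -mulmxBl.
by have := congr1 (fun M => M^t*) PQ; rewrite adjM hP hQ.
Qed.

Lemma mpow_bounds (b : R) (X : 'M[C]_n) : 0 < b < 1 -> psdmx X ->
  leo (1%:M + b%:C *: (X - 1%:M) - (X - 1%:M) *m (X - 1%:M)) (mpow b X) /\
  leo (mpow b X) (1%:M + b%:C *: (X - 1%:M)).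
Proof.
move=> b01 /psd_dgP[U [d [hU d0 ->]]]; have /andP[b0 b1] := b01.
rewrite mpow_dg // -(dg1 hU) dgN dgD dgZ dg_mul // dgN !dgD.
split; apply: leo_dg => i; case: ifPn => di.
- by have := powR_lower2 b01 di; rewrite expr2.
- have -> : d i = 0 by apply/eqP; rewrite eq_le d0 leNgt di.
  by move: b0; lra.
- by have := powR_AM b01 di; lra.
- have -> : d i = 0 by apply/eqP; rewrite eq_le d0 leNgt di.
  by move: b1; lra.
Qed.

Lemma mpow_support (b : R) Q X : Q^t* = Q -> psdmx X -> X *m Q = X ->
  Q *m mpow b X = mpow b X /\ mpow b X *m Q = mpow b X.
Proof.
move=> hQ pX XQ; have QX := herm_fixC hQ (psd_herm pX) XQ.
suff E : Q *m mpow b X = mpow b X.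
  split=> //; have := congr1 (fun M => M^t*) E.
  by rewrite adjM hQ (psd_herm (mpow_psd b pX)).
have [U [d [hU d0 XE]]] := psd_dgP pX.
have -> : mpow b X = X *m dg U (fun i => if 0 < d i then d i `^ b / d i else 0).
  rewrite XE mpow_dg // dg_mul //; apply: eq_dg => i.
  by case: ifPn => di; rewrite ?mulr0 // mulrC divfK ?gt_eqF.
by rewrite mulmxA QX.
Qed.

Lemma conj_expand (b : R) Q (Y D : 'M[C]_n) : Q *m Q = Q -> Q *m Y = D ->
  Y *m Q = D -> D *m Q = D ->
  Q *m (1%:M + b%:C *: Y - Y *m Y) *m Q = Q + b%:C *: D - D *m D /\
  Q *m (1%:M + b%:C *: Y) *m Q = Q + b%:C *: D.
Proof.
move=> QQ QY YQ DQ.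
have E : Q *m (1%:M + b%:C *: Y) *m Q = Q + b%:C *: D.
  by rewrite mulmxDr mulmxDl mulmx1 QQ -scalemxAr -scalemxAl QY DQ.
split=> //; rewrite mulmxBr mulmxBl E; congr (_ - _).
by rewrite mulmxA QY -mulmxA YQ.
Qed.

Lemma conj_support_herm Q (M : 'M[C]_n) : Q^t* = Q -> M^t* = M -> Q *m M = M ->
  M = Q *m M *m Q^t*.
Proof. by move=> hQ hM QM; rewrite QM; have := congr1 (fun M => M^t*) QM; rewrite adjM hQ hM. Qed.

Lemma conj_lin_spec (s t : R) Q (M N : 'M[C]_n) : Q^t* = Q -> Q *m Q = Q ->
  M^t* = M -> N^t* = N ->
  let K := s%:C *: (Q *m M *m Q) + t%:C *: (Q *m N *m Q) in
  [/\ K^t* = K, K *m Q = K & Q *m K = K].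
Proof.
move=> hQ QQ hM hN K; have hconj (X : 'M[C]_n) : X^t* = X -> (Q *m X *m Q)^t* = Q *m X *m Q.
  by move=> hX; rewrite !adjM hQ hX mulmxA.
have hK : K^t* = K by exact: herm_lin (hconj _ hM) (hconj _ hN).
have KQ : K *m Q = K by rewrite /K mulmxDl -!scalemxAl -!(mulmxA _ Q Q) QQ.
by split=> //; exact: herm_fixC hQ hK KQ.
Qed.

Lemma fo_pow (b : R) Q K (X : R -> 'M[C]_n) : 0 < b < 1 -> Q^t* = Q -> Q *m Q = Q ->
  (forall p, 0 < p -> psdmx (X p)) -> (forall p, 0 < p -> X p *m Q = X p) ->
  K^t* = K -> fo X Q K -> fo (fun p => mpow b (X p)) Q (b%:C *: K).
Proof.
move=> b01 hQ QQ pX XQ hK fX.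
have f0 : fo (fun p => X p - Q) 0 K.
  apply: fo_near (fo_eq (foD fX (fo_cst (- Q))) _ _); rewrite ?subrr ?addr0 //.
  exact: nearW.
have fU : fo (fun p => Q + b%:C *: (X p - Q)) Q (b%:C *: K).
  apply: fo_eq (foD (fo_cst Q) (foZ b f0)) _ _; first by rewrite scaler0 addr0.
  by rewrite add0r.
have fL : fo (fun p => Q + b%:C *: (X p - Q) - (X p - Q) *m (X p - Q)) Q (b%:C *: K).
  apply: fo_near (fo_eq (foD fU (foZ (-1) (foM f0 f0))) _ _).
  - by apply: nearW => p; rewrite rmorphN rmorph1 scaleN1r.
  - by rewrite mul0mx scaler0 addr0.
  - by rewrite mul0mx mulmx0 addr0 scaler0 addr0.
have hXQ p : 0 < p -> (X p - Q)^t* = X p - Q.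
  by move=> p0; rewrite adjD adjN hQ (psd_herm (pX p p0)).
have QXQ p : 0 < p -> Q *m (X p - 1%:M) = X p - Q /\ (X p - 1%:M) *m Q = X p - Q.
  move=> p0; rewrite mulmxBr mulmxBl mulmx1 mul1mx XQ //.
  by rewrite (herm_fixC hQ (psd_herm (pX p p0)) (XQ p p0)).
have conjQ p : 0 < p -> Q *m mpow b (X p) *m Q = mpow b (X p).
  by move=> p0; have [-> ->] := mpow_support b hQ (pX p p0) (XQ p p0).
apply: (fo_squeeze _ _ _ hQ _ _ _ fL fU).
- by move=> p p0; exact: psd_herm (mpow_psd b (pX p p0)).
- move=> p p0; move: (X p - Q) (hXQ p p0) => Y hY.
  by rewrite !(adjD, adjN, adjZ, adjM) hY hQ.
- move=> p p0; move: (X p - Q) (hXQ p p0) => Y hY.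
  by rewrite !(adjD, adjZ) hY hQ.
- by rewrite adjZ hK.
- apply: filterS (right0_gt0 R) => p p0; have [h _] := mpow_bounds b01 (pX p p0).
  have [e1 e2] := QXQ p p0; have eD : (X p - Q) *m Q = X p - Q by rewrite mulmxBl XQ // QQ.
  have := leo_conjh hQ h; rewrite (conjQ p p0).
  by have [-> _] := conj_expand b QQ e1 e2 eD.
- apply: filterS (right0_gt0 R) => p p0; have [_ h] := mpow_bounds b01 (pX p p0).
  have [e1 e2] := QXQ p p0; have eD : (X p - Q) *m Q = X p - Q by rewrite mulmxBl XQ // QQ.
  have := leo_conjh hQ h; rewrite (conjQ p p0).
  by have [_ ->] := conj_expand b QQ e1 e2 eD.
Qed.

Lemma fo_arith (a : R) A B : psdmx A -> psdmx B ->
  fo (fun p => (1 - a)%:C *: mpow p A + a%:C *: mpow p B)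
    ((1 - a)%:C *: msupp A + a%:C *: msupp B)
    ((1 - a)%:C *: mlog A + a%:C *: mlog B).
Proof.
move=> pA pB; have f (X : 'M[C]_n) : psdmx X -> fo (fun p => mpow p X) (msupp X) (mlog X).
  move=> pX; have := fo_mpow ltr01 pX; rewrite scale1r; apply: fo_near.
  by apply: nearW => p; rewrite mul1r.
exact: foD (foZ _ (f _ pA)) (foZ _ (f _ pB)).
Qed.

Lemma qf_lin (s t : R) A B (v : 'rV[C]_n) :
  qf (s%:C *: A + t%:C *: B) v = s * qf A v + t * qf B v.
Proof. by rewrite qfD !qfZ. Qed.

Lemma gmean_support (s p : R) A B : 0 < s < 1 -> psdmx A -> psdmx B ->
  gmean s (mpow p A) (mpow p B) *m msupp B = gmean s (mpow p A) (mpow p B).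
Proof.
move=> s01 pA pB; have pA' := mpow_psd p pA; have pB' := mpow_psd p pB.
have [pX _ _] := gmean_bounds s01 pA' pB'.
set X := gmean _ _ _ in pX *; pose Q := msupp B.
have hQ : Q^t* = Q := psd_herm (msupp_psd pB).
have QQ : Q *m Q = Q := msupp_idem pB.
suff E : (1%:M - Q) *m X = 0.
  have {}E : Q *m X = X by apply/esym/subr0_eq; rewrite -[Y in Y - _]mul1mx -mulmxBl.
  by have := congr1 (fun M => M^t*) E; rewrite adjM hQ (psd_herm pX).
apply: row_ext => v; rewrite mulmx0 mulmxA; set w := v *m _.
apply: psd_null => //; apply/eqP; rewrite eq_le psd_qf_ge0 // andbT.
have wB : qf (mpow p B) w = 0.
  rewrite (conj_support_herm hQ (psd_herm pB') (msupp_mpow p pB)).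
  rewrite qf_conj /w -mulmxA mulmxBl mul1mx QQ subrr mulmx0.
  by rewrite qf.unlock mul0mx mul0mx mxE.
rewrite leNgt; apply/negP => x0.
have a0 : 0 <= qf (mpow p A) w := psd_qf_ge0 w pA'.
pose e := qf X w / (2 * (qf (mpow p A) w + 1)).
have D0 : 0 < 2 * (qf (mpow p A) w + 1) by rewrite mulr_gt0 // ltr_wpDl.
have e0 : 0 < e by rewrite divr_gt0.
have [M HM] := gmean_absorb s01 pA' pB' e0.
have : qf X w <= e * qf (mpow p A) w.
  by have := HM w; rewrite [leRHS]qf_lin wB mulr0 addr0.
have E : e * (2 * (qf (mpow p A) w + 1)) = qf X w by rewrite /e divfK ?gt_eqF.
move: E e0 x0 a0; move: (qf X w) (qf (mpow p A) w) => x y; nra.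
Qed.

Lemma proj_lin_spec (p : R) Q K : Q^t* = Q -> Q *m Q = Q -> K^t* = K ->
  K *m Q = K ->
  (Q + p%:C *: K)^t* = Q + p%:C *: K /\ (Q + p%:C *: K) *m Q = Q + p%:C *: K.
Proof.
by move=> hQ QQ hK KQ; rewrite adjD adjZ hQ hK mulmxDl -scalemxAl QQ KQ.
Qed.

Lemma lower_herm (s t : R) (Y M N : 'M[C]_n) : Y^t* = Y -> M^t* = M -> N^t* = N ->
  (Y + Y - Y *m (s%:C *: M + t%:C *: N) *m Y)^t* =
  Y + Y - Y *m (s%:C *: M + t%:C *: N) *m Y.
Proof. by move=> hY hM hN; rewrite !(adjD, adjN, adjM, adjZ) hM hN hY !mulmxA. Qed.

Lemma mnpow_herm (q : R) A : psdmx A -> (mnpow q A)^t* = mnpow q A.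
Proof. by move=> pA; rewrite mnpowE; exact: psd_herm (mpow_psd q (mginv_psd pA)). Qed.

Lemma conj_arith_coefs (s : R) Q (SA SB LA LB : 'M[C]_n) : Q *m Q = Q ->
  Q *m SA = Q -> Q *m SB = Q ->
  Q *m ((1 - s)%:C *: SA + s%:C *: SB) = Q /\
  Q *m ((1 - s)%:C *: LA + s%:C *: LB) *m Q =
  (1 - s)%:C *: (Q *m LA *m Q) + s%:C *: (Q *m LB *m Q).
Proof.
move=> QQ QA QB; split; last by rewrite mulmxDr mulmxDl -!scalemxAr -!scalemxAl.
by rewrite mulmxDr -!scalemxAr QA QB -scalerDl -rmorphD /= subrK scale1r.
Qed.

Lemma lower_family (s : R) A B Q : psdmx A -> psdmx B -> 0 < s < 1 ->
  Q^t* = Q -> Q *m Q = Q -> Q *m msupp A = Q -> Q *m msupp B = Q ->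
  exists L : R -> 'M[C]_n, [/\ forall p, (L p)^t* = L p,
    fo L Q ((1 - s)%:C *: (Q *m mlog A *m Q) + s%:C *: (Q *m mlog B *m Q)) &
    forall p e : R, 0 < e -> leo (L p)
      (hmean_pd s (mpow p A + (e%:C)%:M) (mpow p B + (e%:C)%:M))].
Proof.
move=> pA pB s01 hQ QQ QA QB.
have fL := fo_lower s pA pB hQ QQ QA QB.
have := conj_lin_spec (1 - s) s hQ QQ (mlog_herm pA) (mlog_herm pB).
move: fL; move: (_ + _) => K fL [hK KQ QK].
exists (fun p => Q + p%:C *: K + (Q + p%:C *: K) -
  (Q + p%:C *: K) *m ((1 - s)%:C *: mnpow p A + s%:C *: mnpow p B) *m (Q + p%:C *: K)).
split=> // p; have [hY YQ] := proj_lin_spec p hQ QQ hK KQ.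
  exact: lower_herm hY (mnpow_herm p pA) (mnpow_herm p pB).
move=> e e0; apply: hmean_pd_lower => //.
  by rewrite -[in LHS]YQ -mulmxA QA YQ.
by rewrite -[in LHS]YQ -mulmxA QB YQ.
Qed.

Lemma fo_gmean_support (s : R) A B Q : 0 < s < 1 -> psdmx A -> psdmx B ->
  msupp B = Q -> Q *m msupp A = Q ->
  fo (fun p => gmean s (mpow p A) (mpow p B)) Q
    ((1 - s)%:C *: (Q *m mlog A *m Q) + s%:C *: (Q *m mlog B *m Q)).
Proof.
move=> s01 pA pB QE QA.
have hQ : Q^t* = Q by rewrite -QE; exact: psd_herm (msupp_psd pB).
have QQ : Q *m Q = Q by rewrite -QE; exact: msupp_idem pB.
have QB : Q *m msupp B = Q by rewrite QE.
have [L [hL fL LX]] := lower_family pA pB s01 hQ QQ QA QB.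
have [E1 E2] := conj_arith_coefs s (mlog A) (mlog B) QQ QA QB.
have fU := fo_eq (fo_conj Q (fo_arith s pA pB)) (etrans (congr1 (mulmx^~ Q) E1) QQ) E2.
have [hK _ _] := conj_lin_spec (1 - s) s hQ QQ (mlog_herm pA) (mlog_herm pB).
have pX p : psdmx (gmean s (mpow p A) (mpow p B)).
  by have [] := gmean_bounds s01 (mpow_psd p pA) (mpow_psd p pB).
have XQ p : gmean s (mpow p A) (mpow p B) *m Q = gmean s (mpow p A) (mpow p B).
  by rewrite -QE; exact: gmean_support.
apply: (fo_squeeze _ _ _ hQ hK _ _ fL fU).
- by move=> p _; exact: psd_herm.
- by move=> p _.
- move=> p _; rewrite !adjM hQ mulmxA.
  have := psd_herm (mpow_psd p pA); have := psd_herm (mpow_psd p pB).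
  move: (mpow p A) (mpow p B) => M N hN hM.
  by rewrite adjD !adjZ hM hN.
- apply: nearW => p.
  have [_ h _] := gmean_bounds s01 (mpow_psd p pA) (mpow_psd p pB).
  by apply: h => e; exact: LX.
- apply: nearW => p; have [_ _ h] := gmean_bounds s01 (mpow_psd p pA) (mpow_psd p pB).
  have := leo_conjh hQ h; have := herm_fixC hQ (psd_herm (pX p)) (XQ p).
  by move: (XQ p); move: (gmean _ _ _) => X XQ' QX; rewrite QX XQ'.
Qed.

End MeanLimit.

Section Cases.
Variables (R : realType) (n : nat).
Local Notation C := (R[i]).
Local Notation "0+" := (at_right (0 : R)) (only parsing).
Implicit Types (A B E H K P Q U : 'M[C]_n) (a : R).

Lemma arith_support a P0 P Q : 0 < a < 1 -> P^t* = P -> P *m P = P ->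
  Q^t* = Q -> Q *m Q = Q -> P0 *m P = P0 -> P0 *m Q = P0 ->
  (forall v : 'rV[C]_n, v *m P = v -> v *m Q = v -> v *m P0 = v) ->
  let E := (1 - a)%:C *: P + a%:C *: Q in
  [/\ E^t* = E, P0 *m E = P0, leo E 1%:M &
      forall v, qf E v = nsq v -> v *m P0 = v].
Proof.
move=> /andP[a0 a1] hP PP hQ QQ P0P P0Q fix0 E.
split.
- by rewrite adjD !adjZ hP hQ.
- by rewrite mulmxDr -!scalemxAr P0P P0Q -scalerDl -rmorphD /= subrK scale1r.
- move=> v; rewrite qf_lin qf1.
  have := qf_proj_le v hP PP; have := qf_proj_le v hQ QQ; move: a0 a1; nra.
- move=> v; rewrite qf_lin => h.
  have hp := qf_proj_le v hP PP; have hq := qf_proj_le v hQ QQ.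
  by apply: fix0; apply: proj_fix => //; move: hp hq h a0 a1; nra.
Qed.

Lemma sandwich_support P0 P Q : P^t* = P -> P *m P = P ->
  Q^t* = Q -> Q *m Q = Q -> P0 *m P = P0 -> P0 *m Q = P0 ->
  (forall v : 'rV[C]_n, v *m P = v -> v *m Q = v -> v *m P0 = v) ->
  let E := P *m Q *m P in
  [/\ E^t* = E, P0 *m E = P0, leo E 1%:M &
      forall v, qf E v = nsq v -> v *m P0 = v].
Proof.
move=> hP PP hQ QQ P0P P0Q fix0 E.
have qE v : qf E v = qf Q (v *m P) by rewrite -[in RHS]qf_conj hP.
split.
- by rewrite !adjM hP hQ mulmxA.
- by rewrite !mulmxA P0P P0Q.
- move=> v; rewrite qE qf1; apply: le_trans (qf_proj_le _ hQ QQ) _.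
  by rewrite nsq_proj // qf_proj_le.
- move=> v; rewrite qE => h.
  have h1 := qf_proj_le (v *m P) hQ QQ; have h2 := qf_proj_le v hP PP.
  have n1 := nsq_proj v hP PP.
  have vP : v *m P = v by apply: proj_fix => //; move: h h1 h2; rewrite n1; lra.
  by apply: fix0 => //; apply: proj_fix => //; rewrite -h vP.
Qed.

Lemma between_limit a A B P0 (Z : R -> 'M[C]_n) : 0 < a < 1 -> psdmx A -> psdmx B ->
  P0^t* = P0 -> P0 *m P0 = P0 -> P0 *m msupp A = P0 -> P0 *m msupp B = P0 ->
  (forall v : 'rV[C]_n, v *m msupp A = v -> v *m msupp B = v -> v *m P0 = v) ->
  (forall p, 0 < p -> psdmx (Z p)) ->
  (forall p, 0 < p -> forall L, (forall e : R, 0 < e ->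
    leo L (hmean_pd a (mpow p A + (e%:C)%:M) (mpow p B + (e%:C)%:M))) -> leo L (Z p)) ->
  (forall p, 0 < p -> leo (Z p) ((1 - a)%:C *: mpow p A + a%:C *: mpow p B)) ->
  mcvg (fun p => mpow p^-1 (Z p)) (P0 *m mexp
    ((1 - a)%:C *: (P0 *m mlog A *m P0) + a%:C *: (P0 *m mlog B *m P0))).
Proof.
move=> a01 pA pB h0 PP0 P0A P0B fix0 pZ lowZ upZ.
have [hE P0E E1 fixE] := arith_support a01 (psd_herm (msupp_psd pA)) (msupp_idem pA)
  (psd_herm (msupp_psd pB)) (msupp_idem pB) P0A P0B fix0.
have [L [hL fL LX]] := lower_family pA pB a01 h0 PP0 P0A P0B.
have [_ E2] := conj_arith_coefs a (mlog A) (mlog B) PP0 P0A P0B.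
have [_ KP PK] := conj_lin_spec (1 - a) a h0 PP0 (mlog_herm pA) (mlog_herm pB).
rewrite -E2 in fL KP PK *.
apply: (@mean_limit _ _ P0 _ _ L (fun p => (1 - a)%:C *: mpow p A + a%:C *: mpow p B)
  Z h0 PP0 hE _ P0E E1 fixE pZ).
- have := mlog_herm pA; have := mlog_herm pB.
  by move: (mlog A) (mlog B) => M N hN hM; exact: herm_lin.
- by move=> p _.
- move=> p _; have := psd_herm (mpow_psd p pA); have := psd_herm (mpow_psd p pB).
  by move: (mpow p A) (mpow p B) => M N hN hM; rewrite adjD !adjZ hM hN.
- by move=> p p0; apply: lowZ => // e; exact: LX.
- exact: upZ.
- apply: fo_eq (fo_conj P0 fL) _ _; first by rewrite PP0 PP0.
  by rewrite PK KP.
- exact: fo_arith.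
Qed.

Lemma spectral_mean_coefs a s b c K (LA LB : 'M[C]_n) Q :
  c - 2 * b * (1 - s) = 1 - a -> 2 * b * s = a ->
  K = (1 - s)%:C *: (Q *m - LA *m Q) + s%:C *: (Q *m LB *m Q) ->
  b%:C *: K + c%:C *: (Q *m LA *m Q) + b%:C *: K =
  (1 - a)%:C *: (Q *m LA *m Q) + a%:C *: (Q *m LB *m Q).
Proof.
move=> <- <- ->; rewrite mulmxN mulNmx.
rewrite [(c - _)%:C]rmorphB !rmorphM /= rmorphB /= rmorph1 rmorph_nat.
move: (Q *m LA *m Q) (Q *m LB *m Q) (b%:C) (c%:C) (s%:C) => M N b' c' s'.
by apply/matrixP => i j; rewrite !mxE; ring.
Qed.

Lemma spectral_mean_expansion (b c : R) P Q K (LA : 'M[C]_n) : Q *m P = Q -> Q *m Q = Q ->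
  K *m Q = K -> Q *m K = K ->
  Q *m P *m Q = Q /\
  (b%:C *: K *m P + Q *m (c%:C *: LA)) *m Q + Q *m P *m (b%:C *: K) =
  b%:C *: K + c%:C *: (Q *m LA *m Q) + b%:C *: K.
Proof.
move=> QP QQ KQ QK; rewrite QP QQ; split=> //.
have KP : K *m P = K by rewrite -{1}KQ -mulmxA QP KQ.
by rewrite -!scalemxAl -!scalemxAr KP QK mulmxDl -!scalemxAl KQ.
Qed.

Lemma psd_lin (s t : R) A B : 0 <= s -> 0 <= t -> psdmx A -> psdmx B ->
  psdmx (s%:C *: A + t%:C *: B).
Proof.
move=> s0 t0 /psdmxP[hA pA] /psdmxP[hB pB]; apply/psdmxP; split.
  by rewrite adjD !adjZ hA hB.
by move=> v; rewrite qf_lin addr_ge0 // mulr_ge0.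
Qed.

Lemma sandwich_expansion (s t : R) P Q P0 (LA LB : 'M[C]_n) :
  P^t* = P -> Q^t* = Q -> LA^t* = LA -> LB^t* = LB -> P0^t* = P0 ->
  P0 *m P = P0 -> P0 *m Q = P0 ->
  let H := (s%:C *: LA *m Q + P *m (t%:C *: LB)) *m P + P *m Q *m (s%:C *: LA) in
  H^t* = H /\ P0 *m H *m P0 = (2 * s)%:C *: (P0 *m LA *m P0) + t%:C *: (P0 *m LB *m P0).
Proof.
move=> hP hQ hA hB h0 P0P P0Q H.
have PP0 := congr1 (fun M => M^t*) P0P; rewrite /= adjM hP h0 in PP0.
have QP0 := congr1 (fun M => M^t*) P0Q; rewrite /= adjM hQ h0 in QP0.
have HE : H = s%:C *: (LA *m Q *m P + P *m Q *m LA) + t%:C *: (P *m LB *m P).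
  rewrite /H -!scalemxAl -!scalemxAr mulmxDl -!scalemxAl scalerDr.
  by move: (_ *: _) (_ *: _) (_ *: _) => x y z; exact: addrAC.
split.
  rewrite HE; apply: herm_lin; last by rewrite !adjM hP hB mulmxA.
  by rewrite adjD addrC; congr (_ + _); rewrite !adjM hP hQ hA mulmxA.
rewrite HE mulmxDr mulmxDl -!scalemxAr -!scalemxAl mulmxDr mulmxDl !mulmxA P0P P0Q.
rewrite -!(mulmxA _ P P0) PP0 -(mulmxA _ Q P0) QP0.
by rewrite scalerDr -scalerDl -rmorphD; congr (_%:C *: _ + _); ring.
Qed.

Lemma sandwich_limit a A B P0 : 0 < a < 1 -> psdmx A -> psdmx B ->
  P0^t* = P0 -> P0 *m P0 = P0 -> P0 *m msupp A = P0 -> P0 *m msupp B = P0 ->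
  (forall v : 'rV[C]_n, v *m msupp A = v -> v *m msupp B = v -> v *m P0 = v) ->
  mcvg (fun p => mpow p^-1 (mpow ((1 - a) / 2 * p) A *m mpow (a * p) B
      *m mpow ((1 - a) / 2 * p) A)) (P0 *m mexp
    ((1 - a)%:C *: (P0 *m mlog A *m P0) + a%:C *: (P0 *m mlog B *m P0))).
Proof.
move=> /andP[a0 a1] pA pB h0 PP0 P0A P0B fix0.
have hP := psd_herm (msupp_psd pA); have hQ := psd_herm (msupp_psd pB).
have [hE P0E E1 fixE] := sandwich_support hP (msupp_idem pA) hQ (msupp_idem pB) P0A P0B fix0.
have c0 : 0 < (1 - a) / 2 by rewrite divr_gt0 // subr_gt0.
have fA := fo_mpow c0 pA; have fZ := foM (foM fA (fo_mpow a0 pB)) fA.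
have [hH HE] := sandwich_expansion ((1 - a) / 2) a hP hQ (mlog_herm pA) (mlog_herm pB) h0 P0A P0B.
have pZ p : psdmx (mpow ((1 - a) / 2 * p) A *m mpow (a * p) B *m mpow ((1 - a) / 2 * p) A).
  by apply: psd_conjh; [exact: psd_herm (mpow_psd _ pA)|exact: mpow_psd].
have two : 2 * ((1 - a) / 2) = 1 - a by field.
rewrite two in HE; rewrite -HE.
apply: (@mean_limit _ _ _ _ _ _ _ _ h0 PP0 hE hH P0E E1 fixE
  (fun p _ => pZ p) (fun p _ => psd_herm (pZ p))
  (fun p _ => psd_herm (pZ p)) (fun p _ => @leo_refl _ _ _) (fun p _ => @leo_refl _ _ _) _ fZ).
by apply: fo_eq (fo_conj P0 fZ) _ _; rewrite ?P0E.
Qed.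

(* Both spectral means are of the form X^b A^(cp) X^b with X = A^-p #_s B^p. *)
Lemma spectral_mean_limit a s b c A B : 0 < a < 1 -> 0 < s < 1 -> 0 < b < 1 -> 0 < c ->
  c - 2 * b * (1 - s) = 1 - a -> 2 * b * s = a ->
  psdmx A -> psdmx B -> msupp B *m msupp A = msupp B ->
  mcvg (fun p => mpow p^-1 (mpow b (gmean s (mnpow p A) (mpow p B)) *m
     mpow (c * p) A *m mpow b (gmean s (mnpow p A) (mpow p B))))
   (msupp B *m mexp ((1 - a)%:C *: (msupp B *m mlog A *m msupp B)
     + a%:C *: (msupp B *m mlog B *m msupp B))).
Proof.
move=> a01 s01 b01 c0 e1 e2 pA pB QA.
have pA' := mginv_psd pA.
have hQ := psd_herm (msupp_psd pB); have QQ := msupp_idem pB.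
have fX : fo (fun p => gmean s (mnpow p A) (mpow p B)) (msupp B)
    ((1 - s)%:C *: (msupp B *m - mlog A *m msupp B) + s%:C *: (msupp B *m mlog B *m msupp B)).
  have QA' : msupp B *m msupp (mginv A) = msupp B by rewrite (msupp_mginv pA).
  have := fo_gmean_support s01 pA' pB (erefl _) QA'; rewrite (mlog_mginv pA).
  by apply: fo_near; apply: nearW => p; rewrite mnpowE.
have pX p : psdmx (gmean s (mnpow p A) (mpow p B)).
  by have [] := gmean_bounds s01 (mpow_psd p pA') (mpow_psd p pB).
have XQ p : gmean s (mnpow p A) (mpow p B) *m msupp B = gmean s (mnpow p A) (mpow p B).
  exact: (gmean_support p s01 pA' pB).
have hmA : (- mlog A)^t* = - mlog A by rewrite adjN mlog_herm.
have [hK KQ QK] := conj_lin_spec (1 - s) s hQ QQ hmA (mlog_herm pB).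
have coef := spectral_mean_coefs e1 e2 (erefl ((1 - s)%:C *: (msupp B *m - mlog A *m msupp B)
  + s%:C *: (msupp B *m mlog B *m msupp B))).
have fY := fo_pow b01 hQ QQ (fun p _ => pX p) (fun p _ => XQ p) hK fX.
have [x1 x2] := spectral_mean_expansion b c (mlog A) QA QQ KQ QK.
have fZ := fo_eq (foM (foM fY (fo_mpow c0 pA)) fY) x1 (etrans x2 coef).
have [hK' KQ' QK'] := conj_lin_spec (1 - a) a hQ QQ (mlog_herm pA) (mlog_herm pB).
have pZ p : psdmx (mpow b (gmean s (mnpow p A) (mpow p B)) *m
     mpow (c * p) A *m mpow b (gmean s (mnpow p A) (mpow p B))).
  by apply: psd_conjh; [exact: psd_herm (mpow_psd b (pX p))|exact: mpow_psd].
move: hK' KQ' QK' fZ; move: ((1 - a)%:C *: _ + _) => K' hK' KQ' QK' fZ.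
have QKQ : msupp B *m K' *m msupp B = K' by rewrite QK' KQ'.
rewrite -[X in mexp X]QKQ.
apply: (@mean_limit _ _ _ _ _ _ _ _ hQ QQ hQ hK' QQ (msupp_le1 pB)
  (fun v => proj_fix hQ QQ) (fun p _ => pZ p) (fun p _ => psd_herm (pZ p))
  (fun p _ => psd_herm (pZ p)) (fun p _ => @leo_refl _ _ _) (fun p _ => @leo_refl _ _ _) _ fZ).
by apply: fo_eq (fo_conj (msupp B) fZ) _ _; rewrite ?QQ.
Qed.

End Cases.

Theorem theorem2p3 (R : realType) (n : nat) (a : R) (A B : 'M[R[i]]_n)
  (k : mean_kind) :
  0 < a < 1 -> psdmx A -> psdmx B ->
  ((k = MeanSG \/ k = MeanSGt) -> loewner_le (msupp B) (msupp A)) ->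
  (fun p : R => mean k a p A B) @ at_right 0 --> LE a A B.
Proof.
move=> a01 pA pB sAB; have [a0 a1] := andP a01.
have hP := psd_herm (msupp_psd pA); have PP := msupp_idem pA.
have hQ := psd_herm (msupp_psd pB); have QQ := msupp_idem pB.
have := meet_fix hP PP hQ QQ (meet_proj_spec hP PP hQ QQ).
rewrite /LE; move: (meet_proj _ _) => P0 [h0 PP0 P0A P0B fix0].
apply: cvg_mcvg.
have b0 : 0 < 1 - a by rewrite subr_gt0.
have U := between_limit a01 pA pB h0 PP0 P0A P0B fix0.
have spectral : loewner_le (msupp B) (msupp A) ->
    P0 = msupp B /\ msupp B *m msupp A = msupp B.
  move=> le; have QP := loewner_proj hP PP hQ QQ le; split; last exact: QP.
  have E : msupp B *m P0 = msupp B.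
    by apply: row_ext => v; rewrite mulmxA; apply: fix0; rewrite -mulmxA ?QP ?QQ.
  by rewrite -[LHS]P0B (herm_fixC h0 hQ E).
case: k sAB => /= sAB.
- apply: U => p p0.
  + exact: psd_lin (ltW b0) (ltW a0) (mpow_psd p pA) (mpow_psd p pB).
  + move=> L hL; have [_ h1 h2] := hmean_bounds a01 (mpow_psd p pA) (mpow_psd p pB).
    exact: leo_trans (h1 _ hL) h2.
  + exact: leo_refl.
- by apply: U => p p0; have [] := hmean_bounds a01 (mpow_psd p pA) (mpow_psd p pB).
- by apply: U => p p0; have [] := gmean_bounds a01 (mpow_psd p pA) (mpow_psd p pB).
- have [-> QP] := spectral (sAB (or_introl (erefl _))).
  have := @spectral_mean_limit _ _ a 2^-1 a 1 A B a01 _ a01 ltr01 _ _ pA pB QP.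
  rewrite invr_gt0 ltr0n invf_lt1 ?ltr1n // => /(_ isT) h.
  apply: mcvg_near (h _ _); last 2 first.
  + by field.
  + by field.
  by apply: nearW => p; rewrite (mul1r p).
- have [-> QP] := spectral (sAB (or_intror (erefl _))).
  have := @spectral_mean_limit _ _ a a 2^-1 (2 * (1 - a)) A B a01 a01 _ _ _ _ pA pB QP.
  rewrite invr_gt0 ltr0n invf_lt1 ?ltr1n // => /(_ isT) h.
  apply: h; [by rewrite mulr_gt0|by field|by field].
- exact: sandwich_limit.
Qed.
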